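(* The variety $\mathfrak I^{\mathfrak{sl}}_{\mathfrak 0}$ of semilinear odd involutive FL$_e$-algebras is strongly standard complete; that is, Involutive Uninorm Logic with Fixed Point $\mathbf{IUL}^{fp}$ is strongly standard complete. Explicitly, let $L$ be either of these (the variety, or the logic $\mathbf{IUL}^{fp}$). Then for every theory $T$ (an arbitrary, possibly infinite, set of formulas) and every formula $\varphi$ of $L$, the following are equivalent: (1) $T\vDash_L\varphi$; (2) for every standard $L$-algebra $\mathbf A$ and every $\mathbf A$-model $e$ of $T$, $e$ is an $\mathbf A$-model of $\varphi$.
   Context: An FL$_e$-algebra is a structure $\mathbf X=(X,\leq,\cdot,\rightarrow,t,f)$ such that $(X,\leq)$ is a lattice, $(X,\leq,\cdot,t)$ is a commutative residuated monoid with residual $\rightarrow$ (i.e. $xy\leq z\iff x\rightarrow z\geq y$), and $f$ is an arbitrary constant. The residual complement is $x'=x\rightarrow f$; the algebra is involutive if $(x')'=x$ for all $x$. An involutive FL$_e$-algebra is odd if $t'=t$ (equivalently $f=t$). A chain is a totally ordered algebra. The variety $\mathfrak I^{\mathfrak{sl}}_{\mathfrak 0}$ consists of the odd involutive FL$_e$-algebras that are subdirect products of chains. Formulas are built from countably many propositional variables using connectives for $\wedge,\vee,\cdot,\rightarrow$ and constants $t,f$; for $\mathbf{IUL}^{fp}$ the language additionally contains constants $\bot,\top$, interpreted as the least and greatest elements. For an algebra $\mathbf A$ and an evaluation $e$ of formulas in $\mathbf A$, $e$ is an $\mathbf A$-model of $\varphi$ if $e(\varphi)\geq t$, and an $\mathbf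 A$-model of $T$ if it is an $\mathbf A$-model of each formula in $T$. For $L=\mathfrak I^{\mathfrak{sl}}_{\mathfrak 0}$, $T\vDash_L\varphi$ means that for every $\mathbf A\in\mathfrak I^{\mathfrak{sl}}_{\mathfrak 0}$ (equivalently every chain in it), every $\mathbf A$-model of $T$ is an $\mathbf A$-model of $\varphi$. For $L=\mathbf{IUL}^{fp}$, the algebraic semantics of the logic is constituted by the $\mathrm{IUL}^{fp}$-chains, i.e. the non-trivial bounded odd involutive FL$_e$-chains, and $T\vDash_L\varphi$ means that for every $\mathrm{IUL}^{fp}$-chain $\mathbf A$, every $\mathbf A$-model of $T$ is an $\mathbf A$-model of $\varphi$. A standard $L$-algebra is an $L$-algebra whose universe is the real unit interval $[0,1]$ with its usual order. *)

(* Defs.v *)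
From HB Require Import structures.
From mathcomp Require Import all_boot all_order all_algebra.
From mathcomp Require Import interval_inference classical_sets reals.

Set Implicit Arguments.
Unset Strict Implicit.
Unset Printing Implicit Defensive.

Import Order.Theory GRing.Theory Num.Theory.

Local Open Scope order_scope.

(* The carrier and its lattice order are a parameter, so that a standard
   algebra is literally an FL_e-structure on {i01 R}. *)
Record FLe d (X : latticeType d) := MkFLe {
  fmul : X -> X -> X;
  fres : X -> X -> X;
  ft : X;
  ff : X;
  fmulA : associative fmul;
  fmulC : commutative fmul;
  fmul1 : left_id ft fmul;
  fresP : forall x y z : X, (fmul x y <= z) = (y <= fres x z)
}.

Section Algebras.
Context d (X : latticeType d) (A : FLe X).

Definition rescompl (x : X) : X := fres A x (ff A).

Definition fle_involutive : Prop := forall x : X, rescompl (rescompl x) = x.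

Definition fle_odd : Prop := rescompl (ft A) = ft A.

End Algebras.

Record fle_hom d d' (X : latticeType d) (Y : latticeType d')
    (A : FLe X) (B : FLe Y) (h : X -> Y) : Prop := FLeHom {
  hom_meet : {morph h : x y / x `&` y};
  hom_join : {morph h : x y / x `|` y};
  hom_mul : {morph h : x y / fmul A x y >-> fmul B x y};
  hom_res : {morph h : x y / fres A x y >-> fres B x y};
  hom_t : h (ft A) = ft B;
  hom_f : h (ff A) = ff B
}.

(* The embedding into the product of the chains B i is given by its
   components h i. *)
Definition subdirect_of_chains d (X : latticeType d) (A : FLe X) : Prop :=
  exists (I : Type) (dI : I -> Order.disp_t)
         (Y : forall i, orderType (dI i)) (B : forall i, FLe (Y i))
         (h : forall i, X -> Y i),
  [/\ forall i, fle_hom A (B i) (h i),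
      forall i (y : Y i), exists x : X, h i x = y
    & forall x x' : X, (forall i, h i x = h i x') -> x = x'].

Definition I0sl d (X : latticeType d) (A : FLe X) : Prop :=
  [/\ fle_involutive A, fle_odd A & subdirect_of_chains A].

Definition IULfp_chain d (X : tbOrderType d) (A : FLe X) : Prop :=
  [/\ fle_involutive A, fle_odd A & exists x y : X, x <> y].

Section UnitInterval.
Variable R : numDomainType.

Lemma i01_ge0 (x : {i01 R}) : (Itv01 (lexx 0%R) ler01 : {i01 R}) <= x.
Proof. by rewrite -num_le /=. Qed.

Lemma i01_le1 (x : {i01 R}) : x <= (Itv01 ler01 (lexx 1%R) : {i01 R}).
Proof. by rewrite -num_le /=. Qed.

HB.instance Definition _ :=
  Order.hasBottom.Build ring_display {i01 R} i01_ge0.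
HB.instance Definition _ :=
  Order.hasTop.Build ring_display {i01 R} i01_le1.

End UnitInterval.

(* K is the type of constants of the language other than t and f. *)
Inductive formula (K : Type) : Type :=
| Var of nat
| Const of K
| Tt
| Ff
| And of formula K & formula K
| Or of formula K & formula K
| Mul of formula K & formula K
| Imp of formula K & formula K.

Inductive bound := Bot | Top.

Definition fm : Type := formula void.
Definition fm_bounded : Type := formula bound.

Section Evaluation.
Context d (X : latticeType d) (A : FLe X).
Context (K : Type) (k : K -> X) (v : nat -> X).

Fixpoint eval (phi : formula K) : X :=
  match phi with
  | Var n => v n
  | Const c => k c
  | Tt => ft A
  | Ff => ff A
  | And p q => eval p `&` eval q
  | Or p q => eval p `|` eval q
  | Mul p q => fmul A (eval p) (eval q)
  | Imp p q => fres A (eval p) (eval q)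
  end.

Definition model (phi : formula K) : Prop := ft A <= eval phi.

Definition model_theory (T : set (formula K)) : Prop :=
  forall psi, T psi -> model psi.

End Evaluation.

Definition no_const (X : Type) : void -> X := of_void X.

Definition bound_const d (X : tbOrderType d) (c : bound) : X :=
  match c with Bot => \bot | Top => \top end.

(* Every A-model of T is an A-model of phi, in the language without and with
   the constants Bot and Top. *)
Definition holds_in d (X : latticeType d) (A : FLe X)
    (T : set fm) (phi : fm) : Prop :=
  forall v : nat -> X,
    model_theory A (@no_const X) v T -> model A (@no_const X) v phi.

Definition holds_in_bounded d (X : tbOrderType d) (A : FLe X)
    (T : set fm_bounded) (phi : fm_bounded) : Prop :=
  forall v : nat -> X,
    model_theory A (@bound_const d X) v T -> model A (@bound_const d X) v phi.

Definition entails_I0sl (T : set fm) (phi : fm) : Prop :=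
  forall d (X : latticeType d) (A : FLe X), I0sl A -> holds_in A T phi.

Definition entails_IULfp (T : set fm_bounded) (phi : fm_bounded) : Prop :=
  forall d (X : tbOrderType d) (A : FLe X),
    IULfp_chain A -> holds_in_bounded A T phi.

(* Main.v *)
Require Import Defs.
From HB Require Import structures.
From mathcomp Require Import all_boot all_order all_algebra.
From mathcomp Require Import lra.
From mathcomp Require Import interval_inference boolp classical_sets reals.

Set Implicit Arguments.
Unset Strict Implicit.
Unset Printing Implicit Defensive.

Import Order.Theory GRing.Theory Num.Theory.

Local Open Scope order_scope.

(** An odd involutive FL_e-chain amounts to a totally ordered commutative monoid
with an involution [\~] such that [x <= \~ y] iff [x ** y <= 1] ([oddChain]).
The formulas are countable, so a countermodel in such a chain lives in a
countable subalgebra, and a countermodel in a subdirect product of chains is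
one in some factor. Completeness thus reduces to embedding a countable
nontrivial odd chain [A] into one whose order is the unit interval, keeping the
extreme elements extreme ([standard_embedding]). If [A] has no gaps this is the
Dedekind-MacNeille completion; the work is to fill all gaps of [A] at once.

Let [b] cover [a] and put [x = b ** \~ a]. Whenever [n ** b] exceeds [a] it is
at least [b]; hence no [n ** x] lies strictly between [1] and [x] ([gap_scale]).
Such an [x] is called a scale. The [n] strictly between [\~ x] and [x] form a
convex subalgebra which [x] absorbs, so seen from the scale [x] they are
infinitesimal. The gap can therefore be filled by formal elements that absorb
them too. There is a rational family of these for every pair [h], [k] of
elements that are mutually inverse at the scale [x], meaning
[h ** k ** x = x]. They are multiplied by multiplying the [h], the [k] and the
rational tags, where the tags form a Sugihara chain: the larger scale wins, and
at equal scales the larger absolute value does. New elements of this idempotent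
kind cannot produce further elements inside the infinitesimal part, which is
what makes the extension possible without iterating.

The extended structure is a product of monoids, so its monoid laws are free. Its
order is defined by saying which elements are at most [1]; the single fact with
content is the cut rule [raw_cut], which contains transitivity of the order and
monotonicity of the product, together with totality [raw_total]. Distinct
elements may be equivalent in this order, but no quotient is needed: the
structure ([points]) is only mapped into the interval. It is dense
([points_dense]), so a binary search along an enumeration embeds it densely
([position_i01_dense]), and the operations extend to the whole interval by
suprema of cuts ([completion]). *)

(** * Odd involutive chains *)

(** The last law makes [occ] the residual complement with respect to the unit;
residuation and oddness both follow from it. *)
Record oddChain d (X : orderType d) := OddChain {
  ocmul : X -> X -> X;
  occ : X -> X;
  oc1 : X;
  ocmulA : associative ocmul;
  ocmulC : commutative ocmul;
  ocmul1 : left_id oc1 ocmul;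
  occK : involutive occ;
  occP : forall x y : X, (x <= occ y) = (ocmul x y <= oc1)
}.

HB.instance Definition _ d (X : orderType d) (A : oddChain X) :=
  Monoid.isComLaw.Build X (oc1 A) (ocmul A) (ocmulA A) (ocmulC A) (ocmul1 A).

Section OddChainTheory.
Context d (X : orderType d) (A : oddChain X).
Implicit Types a b c h k l m n p q u v x y z Z : X.

Local Notation "x ** y" := (ocmul A x y) (at level 40, left associativity).
Local Notation "\~ x" := (occ A x) (at level 35, right associativity).
Local Notation e := (oc1 A).

Lemma ocmulr1 : right_id e (ocmul A).
Proof. exact: Monoid.mulm1. Qed.

Lemma ocmulCA x y z : x ** (y ** z) = y ** (x ** z).
Proof. exact: Monoid.mulmCA. Qed.

Lemma ocmulAC x y z : x ** y ** z = x ** z ** y.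
Proof. exact: Monoid.mulmAC. Qed.

Lemma ocmul_le1 x y : (x ** y <= e) = (x <= \~ y).
Proof. by rewrite occP. Qed.

Lemma mulc_le1 x : x ** \~ x <= e.
Proof. by rewrite -occP occK. Qed.

Lemma oc1c : \~ e = e.
Proof.
by apply/eqP; rewrite eq_le occP ocmul1 lexx -{1}[\~ e](ocmul1 A) mulc_le1.
Qed.

Lemma le_occ x y : (\~ x <= \~ y) = (y <= x).
Proof. by rewrite occP ocmulC -occP occK. Qed.

Lemma le_ocmul2r z x y : x <= y -> x ** z <= y ** z.
Proof.
move=> lexy; rewrite -[leRHS](occK A) occP -ocmulA -occP.
by apply: le_trans lexy _; rewrite occP ocmulA mulc_le1.
Qed.

Lemma le_ocmul x y z t : x <= y -> z <= t -> x ** z <= y ** t.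
Proof.
move=> lexy lezt; apply: le_trans (le_ocmul2r _ lexy) _.
by rewrite ![y ** _]ocmulC le_ocmul2r.
Qed.

Lemma le_ocmulr x y : e <= y -> x <= x ** y.
Proof. by move=> /(le_ocmul (lexx x)); rewrite ocmulr1. Qed.

Lemma ge_ocmulr x y : y <= e -> x ** y <= x.
Proof. by move=> /(le_ocmul (lexx x)); rewrite ocmulr1. Qed.

End OddChainTheory.

(* Equality of products up to associativity and commutativity: the last factor
   on the right is pushed to the end on the left, and both are dropped. *)
Ltac oc_push A z := repeat match goal with
  | |- context [ocmul A (ocmul A ?u z) ?y] =>
      first [constr_eq y z; fail 1 | rewrite (ocmulAC A u z y)]
  | |- context [ocmul A z ?y] =>
      first [constr_eq y z; fail 1 | rewrite (ocmulC A z y)]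
  end.

Ltac oc_ac := rewrite /= ?ocmulA; repeat match goal with
  | |- ?L = ?L => reflexivity
  | |- _ = ocmul ?A _ ?z =>
      oc_push A z;
      refine (f_equal (fun y => ocmul A y z) _)
  end.

(** * Scales *)

Section Scales.
Context d (X : orderType d) (A : oddChain X).
Implicit Types a b c h k l m n p q u v x y z Z : X.

Local Notation "x ** y" := (ocmul A x y) (at level 40, left associativity).
Local Notation "\~ x" := (occ A x) (at level 35, right associativity).
Local Notation e := (oc1 A).

(** Multiplying by a scale leaves nothing strictly between the unit and the
scale. All [n] with [\~ x < n < x] are then absorbed by [x]. *)
Definition scale x : bool :=
  `[< e <= x /\ forall n, n ** x <= e \/ x <= n ** x >].

(** Invertible up to a factor that [x] absorbs. *)
Definition unit_at x a : bool := a ** \~ a ** x == x.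

Lemma scale_ge1 x : scale x -> e <= x.
Proof. by move/asboolP=> []. Qed.

Lemma scaleP x n : scale x -> e < n ** x -> x <= n ** x.
Proof.
by move/asboolP=> [_ /(_ n)] [le_nx1|//]; rewrite ltNge le_nx1.
Qed.

Lemma scale1 : scale e.
Proof.
apply/asboolP; split=> // n.
by case/orP: (le_total (n ** e) e) => ?; [left | right].
Qed.

Lemma unit_atC x a : unit_at x (\~ a) = unit_at x a.
Proof. by rewrite /unit_at occK [\~ a ** a]ocmulC. Qed.

Lemma unit_at_ge x a : (x <= a ** \~ a ** x) = unit_at x a.
Proof.
rewrite /unit_at eq_le; have -> //= : a ** \~ a ** x <= x.
by rewrite ocmulC; exact/ge_ocmulr/mulc_le1.
Qed.

(** The left-hand side never exceeds [x], so by the gap below a scale it is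
either [x] or at most the unit. *)
Lemma not_unit_at x a : scale x -> ~~ unit_at x a -> a ** \~ a ** x <= e.
Proof.
move=> sx; rewrite -unit_at_ge; apply: contraNT; rewrite -ltNge.
exact: scaleP.
Qed.

Lemma unit_atM x a b : unit_at x (a ** b) = unit_at x a && unit_at x b.
Proof.
have leM u v : \~ u ** \~ v <= \~ (u ** v).
  rewrite occP [leLHS](_ : _ = (u ** \~ u) ** (v ** \~ v)); last by oc_ac.
  by rewrite -[leRHS](ocmul1 A); apply: le_ocmul; exact: mulc_le1.
have unitMl u v : unit_at x (u ** v) -> unit_at x u.
  rewrite -!unit_at_ge => /le_trans; apply; apply: le_ocmul2r.
  rewrite -ocmulA; apply: le_ocmul; rewrite ?lexx // occP.
  by rewrite [leLHS](_ : _ = u ** v ** \~ (u ** v)) ?mulc_le1 //; oc_ac.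
apply/idP/andP => [uab|[/eqP ua /eqP ub]].
  by split; [apply: unitMl uab | move: uab; rewrite ocmulC; apply: unitMl].
rewrite -unit_at_ge -[leLHS]ua -{1}ub.
rewrite [leLHS](_ : _ = (\~ a ** \~ b) ** (a ** b) ** x); last by oc_ac.
by rewrite [X in _ <= X ** x]ocmulC !le_ocmul2r.
Qed.

(** What is bounded at a smaller scale is infinitesimal at a larger one, unless
it is small there: if [\~ n ** Z] were at most the unit, [n] would be at least
[Z], and then [n ** x] would be at least [Z] too. *)
Lemma scale_lt x Z n : scale x -> scale Z -> x < Z -> n ** x <= x ->
  e < n ** Z -> n ** Z = Z /\ unit_at Z n.
Proof.
move=> sx sZ ltxZ lenx /(scaleP sZ) leZn.
have [leZcn|ltZcn] := leP (\~ n ** Z) e.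
  have /(le_ocmul2r A x) : Z <= n by rewrite -[leRHS](occK A) occP ocmulC.
  move/le_trans/(_ lenx); rewrite leNgt => /negP[].
  by apply: lt_le_trans ltxZ _; apply/le_ocmulr/scale_ge1.
have {}leZcn := scaleP sZ ltZcn.
have lenn : n ** Z <= n ** \~ n ** Z.
  by rewrite -ocmulA ![n ** _]ocmulC le_ocmul2r.
split; last by rewrite -unit_at_ge (le_trans leZn).
apply/eqP; rewrite eq_le leZn andbT; apply: le_trans lenn _.
by rewrite ocmulC; exact/ge_ocmulr/mulc_le1.
Qed.

(** Elements that are mutually inverse at one scale are so at every larger one;
hence pairs of different scales can be multiplied. *)
Lemma scale_pair x Z n : scale x -> scale Z -> x <= Z -> n ** x = x ->
  n ** Z = Z.
Proof.
move=> sx sZ; rewrite le_eqVlt => /predU1P[<- //|ltxZ] nx.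
have [lenZ|ltnZ] := leP (n ** Z) e; last first.
  by apply: (scale_lt sx sZ ltxZ _ ltnZ).1; rewrite nx.
have x1 : x = e.
  apply/eqP; rewrite eq_le scale_ge1 // andbT.
  apply: le_trans lenZ; rewrite -{1}nx ![n ** _]ocmulC.
  exact/le_ocmul2r/ltW.
by move: nx; rewrite x1 ocmulr1 => ->; rewrite ocmul1.
Qed.

End Scales.

(** * Preordered chains given by their elements below the unit *)

(** The predicate [ple1] singles out the elements at most [pone], and the order
is recovered by comparing quotients. The inverse is not required to be
multiplicative, so [pcut] is stronger than transitivity: it also makes the
product monotone. *)
Record prechain := Prechain {
  pt :> Type;
  pmul : pt -> pt -> pt;
  pone : pt;
  pinv : pt -> pt;
  ple1 : pt -> bool;
  pmulA : associative pmul;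
  pmulC : commutative pmul;
  pmul1 : left_id pone pmul;
  pinvK : involutive pinv;
  pinv1 : pinv pone = pone;
  pcut : forall w z v, ple1 (pmul w (pinv z)) -> ple1 (pmul z v) ->
    ple1 (pmul w v);
  ptotal : forall w z, ple1 (pmul w (pinv z)) || ple1 (pmul z (pinv w))
}.

Definition ple (M : prechain) (w z : M) := ple1 (pmul w (pinv z)).

(** * Tags *)

Section Sugihara.
Local Open Scope ring_scope.
Implicit Types s r u : rat.

(** The second argument dominates if it has the larger absolute value or, at
equal absolute values, is the smaller one. Avoiding absolute values keeps the
case distinctions linear. *)
Definition sug_dom s r : bool := if s <= - r then r <= s else s <= r.

(** The product of the Sugihara chain on the rationals, a maximum for the total
preorder [sug_dom]. *)
Definition sug s r : rat := if sug_dom s r then r else s.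

Lemma sugE s r : sug s r = if s <= - r then if r <= s then r else s
  else if s <= r then r else s.
Proof. by rewrite /sug /sug_dom; case: (s <= - r). Qed.

Lemma sug_dom_total s r : ~~ sug_dom s r -> sug_dom r s.
Proof.
by rewrite /sug_dom; case: (leP s (- r)) => ?; case: (leP r (- s)) => ?; lra.
Qed.

Lemma sug_dom_trans s r u : sug_dom s r -> sug_dom r u -> sug_dom s u.
Proof.
rewrite /sug_dom; case: (leP s (- r)) => ?; case: (leP r (- u)) => ?;
  by case: (leP s (- u)) => ?; lra.
Qed.

Lemma sugC : commutative sug.
Proof. 
move=> s r; rewrite !sugE; case: (leP s (- r)) => ?; case: (leP r (- s)) => ?;
  by case: (leP r s) => ?; case: (leP s r) => ?; lra.
 Qed.

Lemma sug0s : left_id 0 sug.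
Proof. 
move=> s; rewrite sugE; case: (leP 0 (- s)) => ?; case: (leP s 0) => ?;
  by case: (leP 0 s) => ?; lra.
 Qed.

Lemma sugA : associative sug.
Proof.
move=> s r u; rewrite /sug.
have [sr|nsr] := boolP (sug_dom s r); have [ru|nru] := boolP (sug_dom r u).
- by rewrite (sug_dom_trans sr ru).
- by rewrite sr.
- by [].
rewrite (negbTE nsr); case: ifP => // su.
by rewrite (sug_dom_trans (sug_dom_total nsr) su) in nru.
Qed.

Lemma sug_le0 s r : (sug s r <= 0) = (s <= - r).
Proof.
rewrite sugE; case: (leP s (- r)) => ?; case: (leP r s) => ?.
- by apply/idP; lra.
- by apply/idP; lra.
- by apply/negbTE; rewrite -ltNge; case: (leP s r) => ?; lra.
- by apply/negbTE; rewrite -ltNge; case: (leP s r) => ?; lra.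
Qed.

Lemma sug_eq0 s r : (sug s r == 0) = (s == 0) && (r == 0).
Proof.
apply/eqP/andP => [|[/eqP-> /eqP->]]; last by rewrite sug0s.
rewrite sugE; case: (leP s (- r)) => ?; case: (leP r s) => ?;
  by case: (leP s r) => ? ?; split; apply/eqP; lra.
Qed.

End Sugihara.

(** * The extension by formal elements *)

Section Points.
Context d (X : orderType d) (A : oddChain X).
Implicit Types a b c h k l m n p q u v x y z Z : X.
Implicit Types t : (X * rat)%type.

Local Notation "x ** y" := (ocmul A x y) (at level 40, left associativity).
Local Notation "\~ x" := (occ A x) (at level 35, right associativity).
Local Notation e := (oc1 A).

Definition tag_mul t1 t2 : X * rat :=
  if t1.1 < t2.1 then t2 else if t2.1 < t1.1 then t1
  else (t1.1, sug t1.2 t2.2).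

Definition tag_opp t : X * rat := (t.1, - t.2)%R.

(** A tag of a scale smaller than [Z] is neutral at [Z]. *)
Definition eff Z t : rat := if t.1 == Z then t.2 else 0%R.

Lemma tag_mul_scale t1 t2 : (tag_mul t1 t2).1 = Order.max t1.1 t2.1.
Proof. by rewrite /tag_mul; case: ltgtP. Qed.

Lemma tag_mulC : commutative tag_mul.
Proof.
move=> t1 t2; rewrite /tag_mul; case: ltgtP => // e12.
by rewrite e12 sugC.
Qed.

Lemma tag_mulA : associative tag_mul.
Proof.
move=> [x s] [y r] [z u]; rewrite /tag_mul /=.
case: (ltgtP y z) => [yz|zy|yz]; case: (ltgtP x y) => [xy|yx|xy] //=.
- by rewrite yz (lt_trans xy yz).
- by rewrite xy yz.
- by rewrite [y < z]ltNge (ltW zy) zy.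
- by rewrite ltNge (ltW (lt_trans zy yx)) (lt_trans zy yx).
- by rewrite xy ltNge (ltW zy) zy.
- by rewrite -yz ltxx.
- by rewrite -yz ltNge (ltW yx) yx.
- by rewrite -yz xy ltxx sugA.
Qed.

Lemma eff_mul Z t1 t2 : t1.1 <= Z -> t2.1 <= Z ->
  eff Z (tag_mul t1 t2) = sug (eff Z t1) (eff Z t2).
Proof.
case: t1 t2 => [x s] [y r]; rewrite /eff /tag_mul /= => lexZ leyZ.
case: (ltgtP x y) => [xy|yx|<-] /=.
- by rewrite (lt_eqF (lt_le_trans xy leyZ)) sug0s.
- by rewrite (lt_eqF (lt_le_trans yx lexZ)) sugC sug0s.
- by case: eqP => // _; rewrite sug0s.
Qed.

Lemma eff_opp Z t : eff Z (tag_opp t) = (- eff Z t)%R.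
Proof. by rewrite /eff; case: ifP => //=; rewrite oppr0. Qed.

(** The raw point [(a, h, k, (x, s))] stands for [a] times a formal element of
scale [x] and tag [s]. The formal element lies between [\~ (k ** x)] and
[h ** x]; with respect to the elements of the chain strictly between these two
it lies above all of them if [s > 0] and below all of them if [s < 0]. If [a] is
not a unit at [x] it absorbs the tag. *)
Record raw := Raw { val_of : X; up : X; dn : X; tag : X * rat }.

Implicit Types w : raw.

Definition raw_mul w1 w2 : raw :=
  Raw (val_of w1 ** val_of w2) (up w1 ** up w2) (dn w1 ** dn w2)
    (tag_mul (tag w1) (tag w2)).

Definition raw_inv w : raw :=
  Raw (\~ (val_of w)) (dn w) (up w) (tag_opp (tag w)).

Definition raw_of a : raw := Raw a e e (e, 0%R).

(** At the trivial scale there is nothing infinitesimal, and the only tag is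
zero; elsewhere the tag zero is excluded, since the point [(1, 1, 1, (x, 0))]
would be its own inverse but different from the unit. *)
Definition raw_valid w : bool :=
  [&& scale A (tag w).1, up w ** dn w ** (tag w).1 == (tag w).1
    & ((tag w).2 == 0%R) == ((tag w).1 == e)].

(** For a negative tag the formal element lies just above [\~ (k ** x)] rather
than just below [h ** x], which gives the weaker bound. *)
Definition raw_le1 w : bool :=
  val_of w ** up w ** (tag w).1 <=
    (if ((tag w).2 < 0)%R && unit_at A (tag w).1 (val_of w) then (tag w).1
     else e).

(** At a scale [Z] at least that of a point, being at most the unit has two
forms: below it by more than an infinitesimal, or infinitesimally close to it
with a tag that does not push upwards. *)
Definition strong Z w : bool := val_of w ** up w ** Z <= e.

Definition weak Z w : bool :=
  [&& e < Z, val_of w ** up w ** Z <= Z, unit_at A Z (val_of w)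
    & (eff Z (tag w) <= 0)%R].

Lemma raw_le1_split Z w : scale A (tag w).1 -> scale A Z -> (tag w).1 <= Z ->
  raw_le1 w -> strong Z w || weak Z w.
Proof.
case: w => a h k [x s]; rewrite /raw_le1 /strong /weak /eff /= => sx sZ lexZ P.
have [le1|lt1] //= := leP (a ** h ** Z) e.
move: lexZ; rewrite le_eqVlt => /predU1P[xZ|ltxZ].
  subst Z; rewrite eqxx; move: P; case: ifP => [/andP[s0 ->] le2|_].
    by rewrite (lt_le_trans lt1 le2) le2 ltW.
  by rewrite leNgt lt1.
have leg : a ** h ** x <= x.
  by apply: le_trans P _; case: ifP => // _; exact: scale_ge1.
have [-> ] := scale_lt sx sZ ltxZ leg lt1.
rewrite unit_atM lexx (lt_eqF ltxZ) lexx (le_lt_trans _ ltxZ) ?scale_ge1 //.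
by move=> /andP[-> _].
Qed.

Lemma strong_le1 Z w : scale A (tag w).1 -> (tag w).1 <= Z -> strong Z w ->
  raw_le1 w.
Proof.
case: w => a h k [x s]; rewrite /raw_le1 /strong /= => sx lexZ le1.
have lex1 : a ** h ** x <= e.
  by apply: le_trans le1; apply: le_ocmul.
by case: ifP => // _; apply: le_trans lex1 _; exact: scale_ge1.
Qed.

Lemma validP w : raw_valid w -> [/\ scale A (tag w).1,
  up w ** dn w ** (tag w).1 = (tag w).1
  & ((tag w).2 == 0%R) = ((tag w).1 == e)].
Proof. by case/and3P=> ? /eqP ? /eqP. Qed.

Lemma raw_valid_mul w1 w2 : raw_valid w1 -> raw_valid w2 ->
  raw_valid (raw_mul w1 w2).
Proof.
case: w1 w2 => a h k [x s] [b l m [y r]] /validP[/= sx hkx s0].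
move=> /validP[/= sy lmy r0].
rewrite /raw_valid /= tag_mul_scale /=.
have sM : scale A (Order.max x y) by case: leP.
rewrite sM /=; apply/andP; split.
  rewrite (_ : _ ** _ = (h ** k) ** ((l ** m) ** Order.max x y)); last by oc_ac.
  rewrite (scale_pair sy sM _ lmy) ?le_max ?lexx ?orbT //.
  by rewrite (scale_pair sx sM _ hkx) ?le_max ?lexx.
rewrite /tag_mul /=; case: ltgtP => /= xy; rewrite ?s0 ?r0 ?eqxx //.
by rewrite sug_eq0 s0 r0 xy andbb.
Qed.

Lemma raw_valid_inv w : raw_valid w -> raw_valid (raw_inv w).
Proof.
case: w => a h k [x s] /validP[/= sx hkx s0].
by rewrite /raw_valid /= oppr_eq0 s0 sx [k ** h]ocmulC hkx !eqxx.
Qed.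

Lemma raw_valid_of a : raw_valid (raw_of a).
Proof. by rewrite /raw_valid /= !ocmul1 scale1 !eqxx. Qed.

(** Everything is compared at the largest scale [Z] involved. If both hypotheses
hold strongly, the value [b] of [z] is removed by residuation; otherwise [b] is a
unit at [Z] and is cancelled. If neither holds strongly, the tags [s], [r], [u]
of the three points at [Z] satisfy [s <= r <= - u], and as [Z] is the scale of
one of the points they are not all zero, so the tag of the product is
negative. *)
Lemma raw_cut (w z v : raw) : raw_valid w -> raw_valid z -> raw_valid v ->
  raw_le1 (raw_mul w (raw_inv z)) -> raw_le1 (raw_mul z v) ->
  raw_le1 (raw_mul w v).
Proof.
move=> Vw Vz Vv; move: (Vw) (Vz) (Vv).
move=> /validP[sw _ _] /validP[sz lmz _] /validP[sv _ _] Nwz Nzv.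
pose Z := Order.max (tag w).1 (Order.max (tag z).1 (tag v).1).
have sZ : scale A Z by rewrite /Z; case: leP => // _; case: leP.
have wZ : (tag w).1 <= Z by rewrite le_max lexx.
have zZ : (tag z).1 <= Z by rewrite !le_max lexx orbT.
have vZ : (tag v).1 <= Z by rewrite !le_max lexx !orbT.
have scale_mul w1 w2 : raw_valid w1 -> raw_valid w2 ->
  scale A (tag (raw_mul w1 w2)).1 by move=> V1 V2; case/validP: (raw_valid_mul V1 V2).
have := raw_le1_split (scale_mul _ _ Vw (raw_valid_inv Vz)) sZ _ Nwz.
rewrite tag_mul_scale ge_max wZ zZ => /(_ isT) Dwz.
have := raw_le1_split (scale_mul _ _ Vz Vv) sZ _ Nzv.
rewrite tag_mul_scale ge_max vZ zZ => /(_ isT) Dzv.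
have tagwv : (tag (raw_mul w v)).1 <= Z by rewrite tag_mul_scale ge_max wZ.
have swv := scale_mul _ _ Vw Vv.
suff : strong Z (raw_mul w v) || [&& e < Z,
    val_of (raw_mul w v) ** up (raw_mul w v) ** Z <= Z,
    unit_at A Z (val_of (raw_mul w v)) & (eff Z (tag (raw_mul w v)) < 0)%R].
  case/orP; first exact: strong_le1.
  rewrite /eff => /and4P[_ leZ uZ]; case: eqP => // tZ lt0.
  by rewrite /raw_le1 tZ lt0 uZ.
move: Dwz Dzv; rewrite /weak !eff_mul ?eff_opp //=.
have {lmz} := scale_pair sz sZ zZ lmz.
rewrite /strong /= !unit_atM unit_atC !sug_le0.
set a := val_of w; set h := up w; set b := val_of z; set l := up z.
set m := dn z; set c := val_of v; set p := up v => lmZ.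
have key u1 : unit_at A Z b -> forall g1 g2 f1 f2, 
    g1 = a ** \~ b ** (h ** m) -> g2 = b ** c ** (l ** p) ->
    f1 ** f2 ** Z = g1 ** g2 ** Z -> f1 ** Z <= u1 -> f2 ** Z <= Z ->
    a ** c ** (h ** p) ** Z <= u1.
  move=> /eqP ub g1 g2 f1 f2 -> -> f12 le1 le2.
  have -> : a ** c ** (h ** p) ** Z = f1 ** f2 ** Z.
    rewrite f12 -{1}lmZ -{1}ub; oc_ac.
  by rewrite -ocmulA; apply: le_trans le1; rewrite ![f1 ** _]ocmulC le_ocmul2r.
case/orP=> [S1|/and4P[Z1 W1 /andP[ua ub] sz1]];
  case/orP=> [S2|/and4P[_ W2 /andP[ub' uc] sz2]].
(* Both strong: bound b from below and its complement as well, then multiply;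
   the spare factor Z is at least the unit. *)
- have H1 : a ** h ** m ** Z <= b.
    by rewrite -[b](occK A) occP [leLHS](_ : _ = a ** \~ b ** (h ** m) ** Z) //; oc_ac.
  have H2 : c ** l ** p ** Z <= \~ b.
    by rewrite occP [leLHS](_ : _ = b ** c ** (l ** p) ** Z) //; oc_ac.
  have /le_trans/(_ (mulc_le1 A b)) := le_ocmul A H1 H2.
  rewrite [leLHS](_ : _ = a ** c ** (h ** p) ** (l ** m ** Z) ** Z); last by oc_ac.
  rewrite lmZ => H; apply/orP; left; apply: le_trans H.
  by apply/le_ocmulr/scale_ge1.
- by rewrite (key e ub' _ _ _ _ erefl erefl erefl).
- by rewrite (key e ub _ _ (b ** c ** (l ** p)) (a ** \~ b ** (h ** m)) erefl erefl) //
    [_ ** (a ** _ ** _)]ocmulC.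
apply/orP; right.
rewrite Z1 (key Z ub _ _ _ _ erefl erefl erefl) // ua uc /=.
rewrite lt_neqAle sug_le0 (le_trans sz1) ?opprK // andbT sug_eq0.
apply/negP => /andP[w0 v0].
have z0 : eff Z (tag z) == 0%R.
  rewrite eq_le; move: sz1 sz2.
  by rewrite (eqP w0) (eqP v0) opprK oppr0 => -> ->.
have eff0 w' : raw_valid w' -> eff Z (tag w') == 0%R -> (tag w').1 != Z.
  case/validP=> _ _; rewrite /eff; case: (eqVneq (tag w').1 Z) => // -> ->.
  by rewrite gt_eqF.
have := eff0 _ Vw w0; have := eff0 _ Vz z0; have := eff0 _ Vv v0.
by rewrite /Z /Order.max; do 2 case: ifP; rewrite eqxx.
Qed.

(** If both quotients exceed the unit, their values times [Z] are at least [Z],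
while the product of the values times [Z] is [d ** Z] for some [d <= 1]. So both
points have values that are units at [Z], and neither of the two tags of the
quotients is negative. One of them is nonpositive, hence zero, and [Z] is the
trivial scale; but there [d ** Z <= 1]. *)
Lemma raw_total w1 w2 : raw_valid w1 -> raw_valid w2 ->
  raw_le1 (raw_mul w1 (raw_inv w2)) || raw_le1 (raw_mul w2 (raw_inv w1)).
Proof.
move=> V1 V2; move: (V1) (V2).
move=> /validP[sc1 hk1 _] /validP[sc2 hk2 _].
pose Z := Order.max (tag w1).1 (tag w2).1.
have sZ : scale A Z by rewrite /Z; case: leP.
have [Z1 Z2] : (tag w1).1 <= Z /\ (tag w2).1 <= Z by rewrite !le_max !lexx orbT.
have {}hk1 := scale_pair sc1 sZ Z1 hk1.
have {}hk2 := scale_pair sc2 sZ Z2 hk2.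
have t12 : (tag_mul (tag w1) (tag_opp (tag w2))).1 = Z.
  by rewrite tag_mul_scale.
have t21 : (tag_mul (tag w2) (tag_opp (tag w1))).1 = Z.
  by rewrite tag_mul_scale maxC.
apply: contraT; rewrite negb_or /raw_le1 /= t12 t21 !unit_atM !unit_atC.
have -> : (tag_mul (tag w1) (tag_opp (tag w2))).2 =
    eff Z (tag_mul (tag w1) (tag_opp (tag w2))) by rewrite /eff t12 eqxx.
have -> : (tag_mul (tag w2) (tag_opp (tag w1))).2 =
    eff Z (tag_mul (tag w2) (tag_opp (tag w1))) by rewrite /eff t21 eqxx.
rewrite !eff_mul // !eff_opp -!ltNge [unit_at A Z (val_of w2) && _]andbC.
set g1 := _ ** _ ** (up w1 ** _); set g2 := _ ** _ ** (up w2 ** _).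
set a := val_of w1 in g1 g2 *; set b := val_of w2 in g1 g2 *.
have g12 : g1 ** (g2 ** Z) = a ** \~ a ** (b ** \~ b) ** Z.
  rewrite /g1 /g2 -[in RHS]hk1 -[in RHS]hk2; oc_ac.
have big n (i : bool) : (if i then Z else e) < n ** Z -> Z <= n ** Z.
  move=> H; apply: (scaleP sZ); apply: le_lt_trans H; case: i => //.
  exact: scale_ge1.
move=> /andP[H1 H2]; have B1 := big _ _ H1; have B2 := big _ _ H2.
have M1 : g1 ** Z <= a ** \~ a ** (b ** \~ b) ** Z.
  by rewrite -g12 ![g1 ** _]ocmulC le_ocmul2r.
have M2 : g2 ** Z <= a ** \~ a ** (b ** \~ b) ** Z.
  rewrite -g12 ocmulCA ![g2 ** _]ocmulC; exact: le_ocmul2r.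
have dle n : a ** \~ a ** (b ** \~ b) ** n <= n.
  rewrite ocmulC; apply: ge_ocmulr; rewrite -[leRHS](ocmul1 A).
  by apply: le_ocmul; exact: mulc_le1.
have NS : ~~ (a ** \~ a ** (b ** \~ b) ** Z <= e).
  rewrite -ltNge; apply: lt_le_trans M1; apply: le_lt_trans H1.
  by case: ifP => // _; exact: scale_ge1.
have uab : unit_at A Z a && unit_at A Z b.
  apply: contraT; rewrite negb_and => /orP[] /(not_unit_at sZ) H.
    case/negP: NS; rewrite ocmulAC; apply: le_trans H.
    exact/ge_ocmulr/mulc_le1.
  case/negP: NS; rewrite -ocmulA ocmulC; apply: le_trans H.
  exact/ge_ocmulr/mulc_le1.
move: H1 H2; rewrite uab !andbT.
have {}M1 := le_trans M1 (dle Z); have {}M2 := le_trans M2 (dle Z).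
case: ifPn => [_|n1]; first by rewrite ltNge M1.
case: ifPn => [_|n2]; first by rewrite [_ < g2 ** _]ltNge M2.
case/negP: NS; suff <- : Z = e by [].
have s1 : (sug (eff Z (tag w1)) (- eff Z (tag w2)) == 0)%R ||
   (sug (eff Z (tag w2)) (- eff Z (tag w1)) == 0)%R.
  move: n1 n2; rewrite !lt_neqAle !sug_le0 !opprK.
  case: eqP => //= _; case: eqP => //= _; rewrite -ltNge => /ltW.
  by move=> ->.
have {s1} [e1 e2] : eff Z (tag w1) = 0%R /\ eff Z (tag w2) = 0%R.
  by case/orP: s1; rewrite sug_eq0 oppr_eq0 => /andP[/eqP-> /eqP->].
have eff0 w : raw_valid w -> eff Z (tag w) = 0%R -> (tag w).1 = Z -> Z = e.
  case/validP=> _ _; rewrite /eff => + + tZ; rewrite tZ eqxx => + w0.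
  by rewrite w0 eqxx => /esym/eqP.
have [le21|/ltW le12] := leP (tag w2).1 (tag w1).1.
  by apply: (eff0 w1) => //; rewrite /Z max_l.
by apply: (eff0 w2) => //; rewrite /Z max_r.
Qed.

Lemma tag_mul1 t : e <= t.1 -> tag_mul (e, 0%R) t = t.
Proof.
case: t => x s /=; rewrite /tag_mul /= le_eqVlt sug0s.
by case/predU1P => [<-|-> //]; rewrite ltxx.
Qed.

Record point := Point { rawp :> raw; point_valid : raw_valid rawp }.

Lemma point_inj (w1 w2 : point) : rawp w1 = rawp w2 -> w1 = w2.
Proof.
case: w1 w2 => [w1 V1] [w2 V2] /= E; subst w2.
by rewrite (bool_irrelevance V1 V2).
Qed.

Definition point_mul (w1 w2 : point) : point :=
  Point (raw_valid_mul (point_valid w1) (point_valid w2)).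

Definition point_inv (w : point) : point :=
  Point (raw_valid_inv (point_valid w)).

Definition point_of a : point := Point (raw_valid_of a).

Lemma point_mulA : associative point_mul.
Proof.
move=> w1 w2 w3; apply: point_inj; rewrite /= /raw_mul /=.
by rewrite !ocmulA tag_mulA.
Qed.

Lemma point_mulC : commutative point_mul.
Proof.
move=> w1 w2; apply: point_inj; rewrite /= /raw_mul /= tag_mulC.
by congr Raw; rewrite ocmulC.
Qed.

Lemma point_mul1 : left_id (point_of e) point_mul.
Proof.
move=> w; apply: point_inj; rewrite /= /raw_mul /= !ocmul1 tag_mul1.
  by case: (rawp w).
by case/validP: (point_valid w) => /scale_ge1.
Qed.

Lemma point_invK : involutive point_inv.
Proof.
move=> w; apply: point_inj; rewrite /= /raw_inv /= occK /tag_opp /= opprK.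
by case: (rawp w) => ? ? ? [].
Qed.

Lemma point_inv1 : point_inv (point_of e) = point_of e.
Proof. by apply: point_inj; rewrite /= /raw_inv /= oc1c /tag_opp /= oppr0. Qed.

Definition points : prechain :=
  @Prechain point point_mul (point_of e) point_inv (fun w : point => raw_le1 w)
   point_mulA point_mulC point_mul1 point_invK point_inv1
   (fun w z v : point => raw_cut (point_valid w) (point_valid z) (point_valid v))
   (fun w z : point => raw_total (point_valid w) (point_valid z)).

(** The elements of the chain are the points of trivial scale. *)
Definition embed a : points := point_of a.

Lemma embedM a b : embed (a ** b) = pmul (embed a) (embed b).
Proof.
by apply: point_inj; rewrite /= /raw_mul /= !ocmul1 tag_mul1.
Qed.

Lemma embedV a : embed (\~ a) = pinv (embed a).
Proof. by apply: point_inj; rewrite /= /raw_inv /= /tag_opp /= oppr0. Qed.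

Lemma ple_embed a b : ple (embed a) (embed b) = (a <= b).
Proof.
rewrite /ple -embedV -embedM /= /raw_le1 /= !ocmulr1.
by rewrite -occP occK.
Qed.

End Points.

(** * Density of the extension *)

Section PrechainTheory.
Context (M : prechain).
Implicit Types w z v : M.

Lemma ple_total w z : ple w z || ple z w.
Proof. exact: ptotal. Qed.

Lemma ple_refl w : ple w w.
Proof. by have := ple_total w w; rewrite orbb. Qed.

Lemma ple_trans z w v : ple w z -> ple z v -> ple w v.
Proof. exact: pcut. Qed.

Lemma ple_inv w z : ple (pinv w) (pinv z) = ple z w.
Proof. by rewrite /ple pinvK pmulC. Qed.

Lemma ple1E w : ple1 w = ple w (pone M).
Proof. by rewrite /ple pinv1 pmulC pmul1. Qed.

Lemma ple_mul2r v w z : ple w z -> ple (pmul w v) (pmul z v).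
Proof.
move=> lewz; rewrite /ple -pmulA; apply: pcut lewz _.
by rewrite pmulA; apply: ple_refl.
Qed.

Lemma ple_mul w z v u : ple w z -> ple v u -> ple (pmul w v) (pmul z u).
Proof.
move=> wz vu; apply: ple_trans (ple_mul2r v wz) _.
by rewrite ![pmul z _]pmulC ple_mul2r.
Qed.

Definition dense_prechain := forall w z : M, ~~ ple z w ->
  exists v, ~~ ple v w /\ ~~ ple z v.

End PrechainTheory.

Section Density.
Context d (X : orderType d) (A : oddChain X).
Implicit Types a b c h k n x y : X.
Implicit Types w v : points A.

Local Notation "x ** y" := (ocmul A x y) (at level 40, left associativity).
Local Notation "\~ x" := (occ A x) (at level 35, right associativity).
Local Notation e := (oc1 A).

Lemma gap_scale a b : a < b -> (forall c, a < c -> b <= c) ->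
  scale A (b ** \~ a).
Proof.
move=> ltab gap; apply/asboolP; split.
  by apply: ltW; rewrite ltNge ocmul_le1 -ltNge occK.
move=> n; rewrite ocmulA; have [|lt1] := leP (n ** b ** \~ a) e; first by left.
right; apply/le_ocmul2r/gap.
by move: lt1; rewrite [e < _]ltNge ocmul_le1 occK -ltNge.
Qed.

Lemma new_pointP h k x r : scale A x -> h ** k ** x = x -> e < x ->
  r != 0%R -> raw_valid A (Raw e h k (x, r)).
Proof.
by move=> sx hk x1 r0; rewrite /raw_valid /= sx hk eqxx (negbTE r0) (gt_eqF x1).
Qed.

(** At the scale [x] of the gap there are new elements just above [a] if [a] is
a unit at [x], and just below [b] if [b] is one. They cannot both be units when
[x] is idempotent, and if neither is one then [\~ a] absorbs [x], so that [x] is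
idempotent and [b], [\~ a] are mutually inverse at [x]. *)
Lemma gap_filled a b : a < b -> (forall c, a < c -> b <= c) ->
  exists v : points A, ~~ ple v (embed A a) /\ ~~ ple (embed A b) v.
Proof.
move=> ltab gap; have sx := gap_scale ltab gap; set x := b ** \~ a in sx.
have x1 : e < x by rewrite /x ltNge ocmul_le1 -ltNge occK.
have lexxx : x <= x ** x by apply/le_ocmulr/ltW.
have xx1 : e < x ** x by apply: lt_le_trans lexxx.
have nxx : unit_at A x a -> unit_at A x b -> x < x ** x.
  move=> ua ub; rewrite ltNge; apply/negP => xx.
  have : unit_at A x x by rewrite /x unit_atM unit_atC ua ub.
  rewrite /unit_at ocmulAC => /eqP E.
  have : x <= e.
    by rewrite -E; apply: le_trans (le_ocmul2r A _ xx) _; exact: mulc_le1.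
  by rewrite leNgt x1.
have not_le (h k : X) (r : rat) (V : raw_valid A (Raw e h k (x, r))) :
    ~~ (\~ a ** h ** x <=
      (if (r < 0)%R && unit_at A x a then x else e)) ->
    ~~ (b ** k ** x <=
      (if (- r < 0)%R && unit_at A x b then x else e)) ->
    exists v : points A, ~~ ple v (embed A a) /\ ~~ ple (embed A b) v.
  move=> H1 H2; exists (Point V); rewrite /ple /= /raw_le1 /=.
  have -> : tag_mul (x, r) (tag_opp (e, 0%R)) = (x, r).
    by rewrite /tag_mul /= ltNge (ltW x1) x1.
  have -> : tag_mul (e, 0%R) (tag_opp (x, r)) = (x, - r)%R.
    by rewrite /tag_mul /= x1.
  by rewrite /= oc1c !ocmul1 !ocmulr1 unit_atC.
have xE : \~ a ** b = x by rewrite ocmulC.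
have [ua|nua] := boolP (unit_at A x a).
  have V : raw_valid A (Raw e a (\~ a) (x, 1%R)).
    by apply: new_pointP => //; apply/eqP.
  apply: (not_le _ _ _ V).
    by rewrite /= [\~ a ** a]ocmulC (eqP ua) -ltNge.
  by rewrite -/x /= -ltNge; case: ifP => // ub; apply: nxx.
have [ub|nub] := boolP (unit_at A x b).
  have V : raw_valid A (Raw e b (\~ b) (x, (-1)%R)).
    by apply: new_pointP => //; apply/eqP.
  apply: (not_le _ _ _ V); first by rewrite xE (negbTE nua) andbF -ltNge.
  by rewrite (eqP ub) opprK /= -ltNge.
have V : raw_valid A (Raw e b (\~ a) (x, 1%R)).
  apply: new_pointP => //; rewrite -/x; apply/eqP; rewrite eq_le lexxx andbT.
  rewrite {1}/x -ocmulA [b ** _]ocmulC {2}/x [b ** _]ocmulC; apply: le_ocmul2r.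
  rewrite occP ocmulAC [\~ a ** a]ocmulC; exact: not_unit_at.
apply: (not_le _ _ _ V).
  by rewrite xE (negbTE nua) andbF -ltNge.
by rewrite -/x (negbTE nub) andbF -ltNge.
Qed.

Definition effective (w : raw X) : bool :=
  unit_at A (tag w).1 (val_of w) && ((tag w).1 != e).

(** A value that is not a unit at [x] absorbs the tag. The element
[\~ (x ** \~ x)] is the largest one absorbed by [x]; multiplying by it makes the
answer correct both when [x] is idempotent, where it is [x] itself, and when it
is not. *)
Lemma not_effective w : ~~ effective w ->
  exists a, ple w (embed A a) /\ ple (embed A a) w.
Proof.
case: w => -[a h k [x s]] V; case/validP: (V) => /= sx hk _.
rewrite /effective negb_and negbK /= => nw.
have small n : ~~ unit_at A x n || (x == e) -> n ** \~ n ** x <= e.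
  by case/orP => [/not_unit_at -> //|/eqP->]; rewrite ocmulr1 mulc_le1.
pose y := \~ (x ** \~ x).
have y1 : e <= y by rewrite occP ocmul1 mulc_le1.
have xy : x ** y = x.
  apply/eqP; rewrite eq_le le_ocmulr // andbT -[leRHS](occK A) occP.
  by rewrite ocmulAC mulc_le1.
exists (a ** h ** y).
have tl : tag_mul (x, s) (tag_opp (e, 0%R)) = (x, s).
  by rewrite tag_mulC /tag_opp oppr0 tag_mul1 ?scale_ge1.
have tr : tag_mul (e, 0%R) (tag_opp (x, s)) = (x, - s)%R.
  by rewrite tag_mul1 ?scale_ge1.
split; rewrite /ple /=; apply: (@strong_le1 _ _ A x);
  rewrite /strong /= ?tl ?tr //=.
- rewrite ocmulr1; have /small H : ~~ unit_at A x (a ** h ** y) || (x == e).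
    by case/orP: nw => [na|->]; rewrite ?orbT // !unit_atM (negbTE na).
  apply: le_trans H.
  rewrite [leLHS](_ : _ = (a ** h ** \~ (a ** h ** y) ** x)); last by oc_ac.
  rewrite [leRHS](_ : _ = (a ** h ** \~ (a ** h ** y) ** x) ** y).
    exact: le_ocmulr.
  oc_ac.
- rewrite ocmul1; apply: le_trans (small _ nw).
  rewrite [leLHS](_ : _ = a ** \~ a ** (h ** k ** (x ** y))); last by oc_ac.
  by rewrite xy hk.
Qed.

Lemma lower_tag (r : rat) : r != 0%R ->
  exists s : rat, [/\ (s < r)%R, s != 0%R & (s < 0)%R = (r < 0)%R].
Proof.
move=> r0; have [lt0|lt0|E] := ltgtP r 0%R; last by rewrite E eqxx in r0.
- by exists (2 * r)%R; split; [lra | rewrite mulf_neq0 | lra].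
- exists (r / 2)%R; split; [lra | by rewrite mulf_neq0 |].
  by apply/negbTE; rewrite -leNgt; lra.
Qed.

(** The last clause is conditional because for [r <= s] the two points have
different values at the common scale, and any smaller tag will do. *)
Lemma between_tag (s r : rat) : exists u : rat,
  [/\ (u < r)%R, u != 0%R & (s < r -> s < u)%R].
Proof.
have [ltsr|lers] := ltP s r; last first.
  exists (Num.min r 0 - 1)%R.
  by case: (leP r 0%R) => ?; (split; [lra | apply/eqP; lra | lra]).
have [m0|m0] := eqVneq ((s + r) / 2)%R 0%R; last first.
  by exists ((s + r) / 2)%R; split=> //; lra.
by exists (r / 2)%R; split; [lra | apply/eqP; lra | lra].
Qed.

Lemma tag_neq0 (w : points A) : effective w -> (tag w).2 != 0%R.
Proof.
case/andP=> _; case/validP: (point_valid w) => _ _ <-.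
by [].
Qed.

(* Replacing the tag of an effective point by a smaller one. *)
Lemma point_retag (w : points A) (s : rat) : effective w -> s != 0%R ->
  (s < (tag w).2)%R ->
  exists v : points A, [/\ rawp v = Raw (val_of w) (up w) (dn w) ((tag w).1, s),
     effective v & ~~ ple w v].
Proof.
move=> effw s0 ltsr; have [sx hk E] := validP (point_valid w).
have V : raw_valid A (Raw (val_of w) (up w) (dn w) ((tag w).1, s)).
  by rewrite /raw_valid /= sx hk eqxx (negbTE s0) /= -E (negbTE (tag_neq0 effw)).
exists (Point V); split => //.
case/andP: effw => uw x1; rewrite /ple /= /raw_le1 /= tag_mul_scale /= maxxx.
rewrite (_ : _ ** _ = val_of w ** \~ (val_of w) ** (up w ** dn w ** (tag w).1));
  last by oc_ac.
rewrite hk (eqP uw) /tag_mul /= ltxx /= (_ : (sug _ _ < 0)%R = false) /=.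
  by rewrite -ltNge lt_neqAle eq_sym x1 scale_ge1.
by apply/negbTE; rewrite -leNgt ltW // ltNge sug_le0 opprK -ltNge.
Qed.

(** Against a point of smaller scale only the sign of the tag matters, so [w2]
can be lowered within its family without passing [w1]. *)
Lemma dense_lt (w1 w2 : points A) : effective w2 ->
  (tag w1).1 < (tag w2).1 -> ~~ ple w2 w1 ->
  exists v, ~~ ple v w1 /\ ~~ ple w2 v.
Proof.
move=> eff2 ltxy nle; have [s [lts s0 sgs]] := lower_tag (tag_neq0 eff2).
have [v [vE _ nv]] := point_retag eff2 s0 lts; exists v; split=> //.
apply: contra nle; rewrite /ple /= /raw_le1 /= vE /= /tag_mul /=.
by rewrite ltNge (ltW ltxy) /= ltxy /= sgs.
Qed.

Lemma dense_eq (w1 w2 : points A) : effective w1 -> effective w2 ->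
  (tag w1).1 = (tag w2).1 -> ~~ ple w2 w1 ->
  exists v, ~~ ple v w1 /\ ~~ ple w2 v.
Proof.
move=> eff1 eff2 exy nle.
have [s [lts s0 sgs]] := between_tag (tag w1).2 (tag w2).2.
have [v [vE _ nv]] := point_retag eff2 s0 lts; exists v; split=> //.
apply: contra nle; rewrite /ple /= /raw_le1 /= vE /= /tag_mul /= exy ltxx /=.
have [/andP[u1 _] /andP[u2 _]] := (eff1, eff2).
rewrite !unit_atM unit_atC u2 -exy u1 !andbT /=.
have ge1 : e <= (tag w1).1 by apply: scale_ge1; case/validP: (point_valid w1).
have [lt12|le21] := ltP (tag w1).2 (tag w2).2.
  rewrite [X in if X then _ else _](_ : _ = false); last first.
    by apply/negbTE; rewrite -leNgt ltW // ltNge sug_le0 opprK -ltNge sgs.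
  by move/le_trans; apply; case: ifP.
have -> : (sug (tag w2).2 (- (tag w1).2) < 0)%R.
  rewrite lt_neqAle sug_le0 opprK le21 andbT sug_eq0.
  by rewrite (negbTE (tag_neq0 eff2)).
by move/le_trans; apply; case: ifP.
Qed.

Lemma effective_inv w : effective (point_inv w) = effective w.
Proof. by rewrite /effective /= unit_atC. Qed.

Lemma points_dense : dense_prechain (points A).
Proof.
have gt (w1 w2 : points A) : effective w1 -> (tag w2).1 < (tag w1).1 ->
    ~~ ple w2 w1 -> exists v, ~~ ple v w1 /\ ~~ ple w2 v.
  rewrite -effective_inv -ple_inv => eff1 lt nle.
  have [v [v1 v2]] := dense_lt (w1 := pinv w2 : points A) eff1 lt nle.
  exists (pinv v); split; first by rewrite -ple_inv pinvK.
  by rewrite -ple_inv pinvK.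
move=> w1 w2 nle.
have [eff1|/not_effective[a [w1a aw1]]] := boolP (effective w1).
  have [eff2|/not_effective[b [w2b bw2]]] := boolP (effective w2).
    have [lt|lt|eq] := ltgtP (tag w1).1 (tag w2).1.
    - exact: dense_lt.
    - exact: gt.
    - exact: dense_eq.
  have /gt : ~~ ple (embed A b) w1.
    by apply: contra nle; apply: ple_trans.
  have lt : (tag (embed A b)).1 < (tag w1).1.
    case/andP: eff1 => _ x1; rewrite lt_neqAle eq_sym x1 scale_ge1 //.
    by case/validP: (point_valid w1).
  case/(_ eff1 lt) => v [v1 v2]; exists v; split=> //.
  by apply: contra v2; apply: ple_trans.
have nle' : ~~ ple w2 (embed A a).
  by apply: contra nle => H; apply: ple_trans H aw1.
suff [v [v1 v2]] : exists v : points A,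
    ~~ ple v (embed A a) /\ ~~ ple w2 v.
  by exists v; split=> //; apply: contra v1 => H; apply: ple_trans H w1a.
have [eff2|/not_effective[b [w2b bw2]]] := boolP (effective w2).
  apply: dense_lt => //=.
  case/andP: eff2 => _ x1; rewrite lt_neqAle eq_sym x1 scale_ge1 //.
  by case/validP: (point_valid w2).
have {nle'} ltab : a < b.
  rewrite ltNge -(ple_embed A); apply: contra nle'; exact: ple_trans.
suff [v [v1 v2]] : exists v : points A,
    ~~ ple v (embed A a) /\ ~~ ple (embed A b) v.
  by exists v; split=> //; apply: contra v2; apply: ple_trans.
have [[c /andP[ac cb]]|nc] := pselect (exists c, a < c < b).
  by exists (embed A c); rewrite !ple_embed -!ltNge.
apply: gap_filled => // c ac; rewrite leNgt; apply/negP => cb.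
by apply: nc; exists c; rewrite ac.
Qed.

End Density.

(** * Extending the operations to a complete chain *)

Section Completion.
Context (M : prechain) d (X : orderType d) (i : M -> X).
Hypothesis i_le : forall w z, (i w <= i z) = ple w z.
Hypothesis i_dense : forall x y : X, x < y -> exists w, x < i w < y.
Hypothesis X_lub : forall S : X -> Prop,
  exists s : X, forall y, s <= y <-> (forall x, S x -> x <= y).

Let lub S : X := projT1 (cid (X_lub S)).

Let lubP S y : lub S <= y <-> (forall x, S x -> x <= y).
Proof. exact: (projT2 (cid (X_lub S)) y). Qed.

Let lub_ub S x : S x -> x <= lub S.
Proof. by move=> Sx; apply: (lubP S _).1 (lexx _) _ Sx. Qed.

(** The operations of the Dedekind-MacNeille completion, transported along the
dense image of [M]. *)
Definition cmul x y : X :=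
  lub (fun u => exists w z, [/\ i w <= x, i z <= y & u = i (pmul w z)]).

Definition cinv x : X :=
  lub (fun u => exists2 z, forall w, i w <= x -> ple1 (pmul w z) & u = i z).

Lemma le_approx x y : (forall w, i w <= x -> i w <= y) -> x <= y.
Proof.
move=> H; rewrite leNgt; apply/negP => /i_dense[w /andP[lty ltx]].
by have := H w (ltW ltx); rewrite leNgt lty.
Qed.

Lemma cmul_le x y u : cmul x y <= u <->
  (forall w z, i w <= x -> i z <= y -> i (pmul w z) <= u).
Proof.
split=> [/lubP H w z wx zy|H]; first by apply: H; exists w, z.
by apply/lubP => _ [w [z [wx zy ->]]]; apply: H.
Qed.

Lemma le_cinv z x :
  i z <= cinv x <-> (forall w, i w <= x -> ple1 (pmul w z)).
Proof.
split=> [lez w wx|H]; last by apply: lub_ub; exists z.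
have : i z <= i (pinv w).
  apply: le_trans lez _; apply/lubP => _ [v Hv ->].
  by rewrite i_le /ple pinvK pmulC Hv.
by rewrite i_le /ple pinvK pmulC.
Qed.

Lemma le_cinvP x y :
  x <= cinv y <-> (forall w z, i w <= x -> i z <= y -> ple1 (pmul w z)).
Proof.
split=> [lex w z wx zy|H].
  by rewrite pmulC; apply: (le_cinv w y).1 (le_trans wx lex) _ zy.
by apply: le_approx => w wx; apply/le_cinv => z zy; rewrite pmulC H.
Qed.

Lemma le_cinvC x y : x <= cinv y <-> y <= cinv x.
Proof.
by split=> /le_cinvP H; apply/le_cinvP => w z wx zy; rewrite pmulC H.
Qed.

Lemma cinvK : involutive cinv.
Proof.
move=> x; apply/le_anti/andP; split; last exact/le_cinvC.
apply: le_approx => z /le_cinv H; rewrite leNgt; apply/negP => /i_dense[v].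
case/andP=> ltv; rewrite ltNge i_le => /negP; apply.
rewrite /ple pmulC; apply: H; apply/le_cinv => w wx.
by rewrite -/(ple _ _) -i_le (le_trans wx) ?ltW.
Qed.

(** The right-hand side is symmetric in [x], [y] and [u], which is the source of
all commutation properties of the completed product. *)
Lemma cmul_le_cinv x y u : cmul x y <= cinv u <->
  (forall w z v, i w <= x -> i z <= y -> i v <= u ->
     ple1 (pmul (pmul w z) v)).
Proof.
split=> [/cmul_le H w z v wx zy vu|H].
  by have /le_cinv/(_ _ vu) := H _ _ wx zy; rewrite pmulC.
by apply/cmul_le => w z wx zy; apply/le_cinv => v vu; rewrite pmulC H.
Qed.

Lemma cmulC : commutative cmul.
Proof.
have le x y : cmul x y <= cmul y x.
  apply/cmul_le => w z wx zy; rewrite pmulC.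
  exact: (cmul_le _ _ _).1 (lexx _) _ _ zy wx.
by move=> x y; apply/le_anti; rewrite !le.
Qed.

Lemma cmul_swap x y u : cmul x y <= cinv u <-> x <= cinv (cmul y u).
Proof.
split=> [/cmul_le_cinv H|/le_cinvC/cmul_le_cinv H].
  apply/le_cinvC/cmul_le_cinv => w z v wy zu vx.
  by rewrite pmulC pmulA H.
by apply/cmul_le_cinv => w z v wx zy vu; rewrite -pmulA pmulC H.
Qed.

Lemma cmulAP x y z u : cmul (cmul x y) z <= cinv u <->
  (forall a b c v, i a <= x -> i b <= y -> i c <= z -> i v <= u ->
     ple1 (pmul (pmul (pmul a b) c) v)).
Proof.
split=> [/cmul_swap/cmul_le H a b c v ax by' cz vu|H].
  have /le_cinvC/cmul_le_cinv := H _ _ ax by'.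
  by move=> /(_ _ _ _ cz vu (lexx _)); rewrite pmulC pmulA.
apply/cmul_swap/cmul_le => a b ax by'; apply/le_cinvC/cmul_le_cinv.
move=> c v w cz vu; rewrite i_le => wab.
have : ple1 (pmul (pmul (pmul c v) (pmul a b)) (pone M)).
  by rewrite [pmul _ (pone M)]pmulC pmul1 pmulC pmulA H.
rewrite [pmul _ (pone M)]pmulC pmul1 !ple1E => H'; apply: ple_trans H'.
by apply: ple_mul; rewrite ?ple_refl.
Qed.

Lemma cmulA : associative cmul.
Proof.
have le x y z : cmul (cmul x y) z <= cmul (cmul y z) x.
  rewrite -[leRHS]cinvK; apply/cmulAP => a b c v ax by' cz.
  have : cmul (cmul y z) x <= cinv (cinv (cmul (cmul y z) x)).
    by rewrite cinvK.
  move=> /cmulAP H vu; have := H _ _ _ _ by' cz ax vu.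
  by rewrite [pmul _ a]pmulC pmulA.
move=> x y z; rewrite [cmul x _]cmulC; apply/le_anti; rewrite le /= andbT.
exact: le_trans (le _ _ _) (le _ _ _).
Qed.

Lemma cmul1 : left_id (i (pone M)) cmul.
Proof.
move=> x; apply/le_anti/andP; split.
  apply/cmul_le => w z; rewrite i_le => w1; apply: le_trans.
  by rewrite i_le; have := ple_mul2r z w1; rewrite pmul1.
apply: le_approx => w wx; rewrite -[w]pmul1.
exact: (cmul_le _ _ _).1 (lexx _) _ _ (lexx _) wx.
Qed.

Lemma cinvP x y : (x <= cinv y) = (cmul x y <= i (pone M)).
Proof.
apply/idP/idP => [/le_cinvP H|/cmul_le H].
  by apply/cmul_le => w z wx zy; rewrite i_le -ple1E H.
by apply/le_cinvP => w z wx zy; rewrite ple1E -i_le H.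
Qed.

Definition completion : oddChain X := OddChain cmulA cmulC cmul1 cinvK cinvP.

Lemma completionM w z : i (pmul w z) = ocmul completion (i w) (i z).
Proof.
apply/le_anti/andP; split.
  exact: (cmul_le _ _ _).1 (lexx _) _ _ (lexx _) (lexx _).
by apply/cmul_le => a b; rewrite !i_le; apply: ple_mul.
Qed.

Lemma completionV w : i (pinv w) = occ completion (i w).
Proof.
apply/le_anti/andP; split.
  apply/le_cinv => z; rewrite i_le => zw; rewrite ple1E.
  apply: ple_trans (ple_mul2r _ zw) _.
  by rewrite -ple1E; apply: ple_refl.
apply: le_approx => z /le_cinv/(_ w (lexx _)).
by rewrite i_le /ple pinvK pmulC.
Qed.

End Completion.

(** * Dense embedding of a countable dense chain into the unit interval *)

Section DyadicSearch.
Context (R : realType) (T : Type) (le : rel T) (f : nat -> T).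
Hypothesis le_tot : forall w z, le w z || le z w.
Hypothesis le_tr : forall z w v, le w z -> le z v -> le w v.
Hypothesis f_surj : forall w, exists n, f n = w.

Local Notation lt w z := (~~ le z w).

Hypothesis le_dense : forall w z, lt w z -> exists v, lt w v /\ lt v z.
Hypothesis nontriv : exists w z, lt w z.

Implicit Types (w z t x : T) (lo hi : option T) (n k : nat) (p q r : R).

Let le_re w : le w w.
Proof. by have := le_tot w w; rewrite orbb. Qed.

Let lt_le w z : lt w z -> le w z.
Proof. by move=> /negbTE E; have := le_tot w z; rewrite E orbF. Qed.

Let lt_le_tr z w v : lt w z -> le z v -> lt w v.
Proof. by move=> wz zv; apply: contra wz; apply: le_tr. Qed.

Let le_lt_tr z w v : le w z -> lt z v -> lt w v.
Proof. by move=> wz; apply: contra => vw; apply: le_tr vw wz. Qed.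

Definition interior w : bool := `[< (exists z, lt z w) /\ exists z, lt w z >].

Definition between lo hi t : bool :=
  [&& interior t, (if lo is Some l then lt l t else true)
    & (if hi is Some h then lt t h else true)].

(** The index of the earliest enumerated element strictly between [lo] and
[hi], where [None] stands for a missing bound. *)
Definition first lo hi : nat :=
  if pselect (exists n, between lo hi (f n)) is left ex then ex_minn ex else 0%N.

Lemma firstP lo hi t : between lo hi t ->
  between lo hi (f (first lo hi)) /\
  (forall n, between lo hi (f n) -> (first lo hi <= n)%N).
Proof.
move=> bt; rewrite /first; case: pselect => [ex|nex].
  by case: ex_minnP.
by case: nex; have [n fn] := f_surj t; exists n; rewrite fn.
Qed.

Lemma between_lo lo hi x : between lo hi x -> exists t, between lo (Some x) t.
Proof.
case/and3P=> ix lox _; have [[z zx] _] := asboolP _ ix.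
have [w [lw wx]] : exists w, (if lo is Some l then lt l w else lt z w) /\ lt w x.
  by case: lo lox => [l lx|_]; apply: le_dense.
exists w; apply/and3P; split=> //; last by case: lo lox lw.
apply/asboolP; split; last by exists x.
by case: lo lox lw => [l _ lw|_ zw]; [exists l | exists z].
Qed.

Lemma between_hi lo hi x : between lo hi x -> exists t, between (Some x) hi t.
Proof.
case/and3P=> ix _ hix; have [_ [z xz]] := asboolP _ ix.
have [w [xw wh]] : exists w, lt x w /\ (if hi is Some h then lt w h else lt w z).
  by case: hi hix => [h hx|_]; apply: le_dense.
exists w; apply/and3P; split=> //; last by case: hi hix wh.
apply/asboolP; split; first by exists x.
by case: hi hix wh => [h _ wh|_ zw]; [exists h | exists z].
Qed.

Lemma between_widen lo hi x t : between lo hi x ->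
  between lo (Some x) t || between (Some x) hi t -> between lo hi t.
Proof.
case/and3P=> _ lox hix /orP[] /and3P[it a b]; apply/and3P; split=> //.
  by case: hi hix => // h; apply: le_lt_tr; apply: lt_le.
case: lo lox => // l lx; apply: lt_le_tr lx _; exact: lt_le.
Qed.

Lemma first_lt lo hi lo' hi' : let x := f (first lo hi) in
  between lo hi x ->
  (lo' = lo /\ hi' = Some x) \/ (lo' = Some x /\ hi' = hi) ->
  (first lo hi < first lo' hi')%N.
Proof.
move=> x bx H; have [t bt] : exists t, between lo' hi' t.
  by case: H => -[-> ->]; [apply: between_lo bx | apply: between_hi bx].
have [b' _] := firstP bt; have [_ min] := firstP bx.
have b'' : between lo hi (f (first lo' hi')).
  by apply: between_widen bx _; case: H b' => -[-> ->] ->; rewrite ?orbT.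
rewrite ltn_neqAle min // andbT; apply/eqP => E.
by case: H E b' => -[-> ->] <-; rewrite /between /= -/x le_re /= ?andbF.
Qed.

(** Binary search in the tree whose root at the interval from [lo] to [hi] is the
earliest enumerated element, placed at the midpoint of [p] and [q]. The search
is cut off after [k] steps; since the index of the root grows at every step, the
[n]-th element is found within [n] steps. *)
Fixpoint search k lo hi p q t : R :=
  let x := f (first lo hi) in let m := ((p + q) / 2)%R in
  if k is k'.+1 then
    if lt t x then search k' lo (Some x) p m t
    else if lt x t then search k' (Some x) hi m q t
    else m
  else m.

Lemma search_bounds k lo hi p q t : (p < q)%R ->
  (p < search k lo hi p q t < q)%R.
Proof.
elim: k lo hi p q => [|k IH] lo hi p q ltpq /=; first by apply/andP; lra.
case: ifP => _; last case: ifP => _; last by apply/andP; lra.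
  have /(IH lo (Some (f (first lo hi)))) /andP[-> H] : (p < (p + q) / 2)%R by lra.
  by apply: lt_trans H _; lra.
have /(IH (Some (f (first lo hi))) hi) /andP[H ->] : ((p + q) / 2 < q)%R by lra.
by rewrite andbT; apply: lt_trans H; lra.
Qed.

Lemma search_mono k lo hi p q t t' : (p < q)%R -> le t t' ->
  (search k lo hi p q t <= search k lo hi p q t')%R.
Proof.
elim: k lo hi p q => [|k IH] lo hi p q ltpq lett //=.
set x := f _; set m := ((p + q) / 2)%R.
have pm : (p < m)%R by rewrite /m; lra.
have mq : (m < q)%R by rewrite /m; lra.
have [tx|xt] := boolP (lt t x); have [t'x|xt'] := boolP (lt t' x).
- exact: IH.
- have /andP[_ /ltW H] := search_bounds k lo (Some x) t pm.
  apply: le_trans H _; case: ifP => // _.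
  by have /andP[/ltW] := search_bounds k (Some x) hi t' mq.
- by case/negP: xt; apply: le_lt_tr t'x.
have [xlt|tx] := boolP (lt x t).
  by rewrite (lt_le_tr xlt lett) IH.
case: ifP => // _.
by have /andP[/ltW] := search_bounds k (Some x) hi t' mq.
Qed.

Lemma search_strict k lo hi p q n n' : (p < q)%R ->
  between lo hi (f n) -> between lo hi (f n') ->
  (n <= first lo hi + k)%N -> (n' <= first lo hi + k)%N -> lt (f n) (f n') ->
  (search k lo hi p q (f n) < search k lo hi p q (f n'))%R.
Proof.
elim: k lo hi p q => [|k IH] lo hi p q ltpq bt bt' len len' ltt /=.
  have [_ min] := firstP bt; move: len len'; rewrite addn0 => len len'.
  have E : n = n' by apply/eqP; rewrite eqn_leq; apply/andP; split;
    apply: leq_trans (min _ _).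
  by rewrite E le_re in ltt.
have [bx _] := firstP bt.
set x := f _ in bx *; set m := ((p + q) / 2)%R.
have pm : (p < m)%R by rewrite /m; lra.
have mq : (m < q)%R by rewrite /m; lra.
have lenl j : (j <= first lo hi + k.+1)%N -> (j <= first lo (Some x) + k)%N.
  by move=> /leq_trans; apply; rewrite addnS -addSn leq_add2r;
    apply: first_lt => //; left.
have lenr j : (j <= first lo hi + k.+1)%N -> (j <= first (Some x) hi + k)%N.
  by move=> /leq_trans; apply; rewrite addnS -addSn leq_add2r;
    apply: first_lt => //; right.
have bl j : between lo hi (f j) -> lt (f j) x -> between lo (Some x) (f j).
  by case/and3P=> i1 i2 _ i3; apply/and3P.
have br j : between lo hi (f j) -> lt x (f j) -> between (Some x) hi (f j).
  by case/and3P=> i1 _ i2 i3; apply/and3P.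
have [tx|xt] := boolP (lt (f n) x); have [t'x|xt'] := boolP (lt (f n') x).
- by apply: IH; auto.
- have /andP[_ H] := search_bounds k lo (Some x) (f n) pm.
  apply: lt_le_trans H _; case: ifP => // _.
  by have /andP[/ltW] := search_bounds k (Some x) hi (f n') mq.
- by case/negP: xt; apply: le_lt_tr t'x; apply: lt_le.
have xt'' : lt x (f n') by apply: le_lt_tr ltt; rewrite negbK in xt.
rewrite xt''; have [xlt|tx] := boolP (lt x (f n)); first by apply: IH; auto.
by have /andP[] := search_bounds k (Some x) hi (f n') mq.
Qed.

Lemma search_stable k lo hi p q n : between lo hi (f n) ->
  (n <= first lo hi + k)%N ->
  search k.+1 lo hi p q (f n) = search k lo hi p q (f n).
Proof.
elim: k lo hi p q => [|k IH] lo hi p q bt len.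
  have [_ /(_ _ bt) min] := firstP bt; rewrite addn0 in len.
  have -> /= : n = first lo hi by apply/eqP; rewrite eqn_leq len.
  by rewrite le_re.
have [bx _] := firstP bt.
rewrite [LHS]/= [RHS]/=; case: ifP => tx.
  apply: IH; first by case/and3P: bt => i1 i2 _; apply/and3P.
  by apply: leq_trans len _; rewrite addnS -addSn leq_add2r;
    apply: first_lt => //; left.
case: ifP => // xt; apply: IH; first by case/and3P: bt => i1 _ i2; apply/and3P.
by apply: leq_trans len _; rewrite addnS -addSn leq_add2r;
  apply: first_lt => //; right.
Qed.

(** Each step towards [r] halves the interval of values, and density of the
order provides an element in the half that is needed. *)
Lemma search_dense j lo hi p q r : (exists t, between lo hi t) -> (p < q)%R ->
  (p < r < q)%R -> exists2 t, between lo hi t &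
  exists K, forall k, (K <= k)%N ->
    (`|search k lo hi p q t - r| <= (q - p) / 2 ^+ j)%R.
Proof.
elim: j lo hi p q => [|j IH] lo hi p q [t0 bt0] ltpq /andP[pr rq].
  exists t0 => //; exists 0%N => k _; rewrite expr0 divr1.
  have /andP[H1 H2] := search_bounds k lo hi t0 ltpq.
  by rewrite ler_norml; apply/andP; lra.
have [bx _] := firstP bt0.
set x := f _ in bx; set m := ((p + q) / 2)%R.
have pm : (p < m)%R by rewrite /m; lra.
have mq : (m < q)%R by rewrite /m; lra.
have [rm|mr|rm] := ltgtP r m.
- have [|t bt [K HK]] := IH lo (Some x) p m (between_lo bx) pm; first by rewrite pr.
  exists t; first by apply: between_widen bx _; rewrite bt.
  exists K.+1 => -[//|k] ltK; rewrite /= -/x -/m.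
  have -> : lt t x by case/and3P: bt.
  have -> : ((q - p) / 2 ^+ j.+1 = (m - p) / 2 ^+ j)%R.
    by rewrite exprS /m invfM; lra.
  exact: HK.
- have [|t bt [K HK]] := IH (Some x) hi m q (between_hi bx) mq; first by rewrite mr.
  exists t; first by apply: between_widen bx _; rewrite bt orbT.
  exists K.+1 => -[//|k] ltK; rewrite /= -/x -/m.
  have xt : lt x t by case/and3P: bt.
  rewrite (lt_le xt) xt /=.
  have -> : ((q - p) / 2 ^+ j.+1 = (q - m) / 2 ^+ j)%R.
    by rewrite exprS /m invfM; lra.
  exact: HK.
exists x => //; exists 1%N => -[//|k] _; rewrite /= -/x -/m le_re /= rm subrr normr0.
by rewrite divr_ge0 ?exprn_ge0 ?ler0n //; lra.
Qed.

Let idx w : nat := projT1 (cid (f_surj w)).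

Let fidx w : f (idx w) = w.
Proof. exact: (projT2 (cid (f_surj w))). Qed.

(** Extreme elements take no part in the search and go to the endpoints. *)
Definition position w : R :=
  if interior w then search (idx w) None None 0 1 w
  else if `[< exists z, lt z w >] then 1%R else 0%R.

Lemma position_search w k : interior w -> (idx w <= k)%N ->
  position w = search k None None 0 1 w.
Proof.
move=> iw; rewrite /position iw => /subnK <-; elim: (k - _)%N => // j IH.
rewrite IH addSn; have := @search_stable (j + idx w) None None 0 1 (idx w).
rewrite fidx => -> //; first by rewrite /between iw.
by rewrite addnA leq_addl.
Qed.

Lemma position_int w : interior w -> (0 < position w < 1)%R.
Proof. by move=> iw; rewrite /position iw; apply: search_bounds. Qed.

Lemma position01 w : (0 <= position w <= 1)%R.
Proof.
case: (boolP (interior w)) => iw.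
  by have /andP[/ltW -> /ltW ->] := position_int iw.
by rewrite /position (negbTE iw); case: ifP => _; rewrite !lexx ler01.
Qed.

Lemma position_mono w z : le w z -> (position w <= position z)%R.
Proof.
move=> wz; have [iw|niw] := boolP (interior w); have [iz|niz] := boolP (interior z).
- rewrite (@position_search w (idx w + idx z)) ?leq_addr //.
  by rewrite (@position_search z (idx w + idx z)) ?leq_addl // search_mono.
- rewrite [leRHS]/position (negbTE niz) asboolT.
    by have /andP[] := position01 w.
  by have [[v vw] _] := asboolP _ iw; exists v; apply: lt_le_tr wz.
- rewrite {1}/position (negbTE niw) asboolF.
    by have /andP[] := position01 z.
  move=> ex; case/asboolP: niw; split=> //.
  by have [_ [v zv]] := asboolP _ iz; exists v; apply: le_lt_tr zv.
rewrite /position (negbTE niw) (negbTE niz).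
case: asboolP => [[v vw]|_]; last by case: ifP.
by rewrite asboolT //; exists v; apply: lt_le_tr wz.
Qed.

Lemma position_strict w z : lt w z -> (position w < position z)%R.
Proof.
move=> wz; have [iw|niw] := boolP (interior w); have [iz|niz] := boolP (interior z).
- pose k := (idx w + idx z)%N.
  rewrite (@position_search w k) ?leq_addr // (@position_search z k) ?leq_addl //.
  have H v : interior v -> between None None v by rewrite /between => ->.
  have := @search_strict k None None 0 1 (idx w) (idx z) ltr01.
  rewrite !fidx; apply; rewrite ?H //; first by rewrite addnCA leq_addr.
  by rewrite addnA leq_addl.
- rewrite {2}/position (negbTE niz) asboolT; last by exists w.
  by have /andP[] := position_int iw.
- rewrite {1}/position (negbTE niw) asboolF; first by have /andP[] := position_int iz.
  by move=> ex; case/asboolP: niw; split=> //; exists z.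
rewrite /position (negbTE niw) (negbTE niz) asboolF ?asboolT ?ltr01 //.
  by exists w.
by move=> ex; case/asboolP: niw; split=> //; exists z.
Qed.

Lemma position_le w z : (position w <= position z)%R = le w z.
Proof.
apply/idP/idP; last exact: position_mono.
by apply: contraTT => /position_strict; rewrite ltNge.
Qed.

Lemma position_dense p q : (0 <= p)%R -> (p < q)%R -> (q <= 1)%R ->
  exists w, (p < position w < q)%R.
Proof.
move=> p0 pq q1; pose r := ((p + q) / 2)%R.
have ne : exists t, between None None t.
  have [w [z wz]] := nontriv; have [v [wv vz]] := le_dense wz; exists v.
  by rewrite /between !andbT; apply/asboolP; split; [exists w | exists z].
have [j Hj] : exists j, (1 / 2 ^+ j < (q - p) / 2 :> R)%R.
  have D0 : (0 < (q - p) / 2)%R by lra.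
  exists (Num.bound ((q - p) / 2)^-1)%R.
  rewrite div1r -[ltRHS]invrK ltf_pV2 ?posrE ?invr_gt0 ?exprn_gt0 //.
  apply: lt_trans (archi_boundP _) _; first by rewrite invr_ge0 ltW.
  by rewrite -natrX ltr_nat ltn_expl.
have r01 : (0 < r < 1)%R by rewrite /r; apply/andP; lra.
have [w /and3P[iw _ _] [K HK]] := search_dense j ne ltr01 r01.
exists w; have := HK (K + idx w)%N (leq_addr _ _).
rewrite -position_search ?leq_addl // subr0 ler_norml => /andP[H1 H2].
by move: H1 H2 Hj; rewrite /r => H1 H2 Hj; apply/andP; lra.
Qed.

Definition position_i01 w : {i01 R} :=
  Itv01 (andP (position01 w)).1 (andP (position01 w)).2.

Lemma position_i01_le w z : (position_i01 w <= position_i01 z) = le w z.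
Proof. by rewrite -num_le /= position_le. Qed.

Lemma position_i01_dense (x y : {i01 R}) : x < y ->
  exists w, x < position_i01 w < y.
Proof.
rewrite -num_lt => xy; have [|||w] := @position_dense x%:num%R y%:num%R => //.
by move=> H; exists w; rewrite -!num_lt.
Qed.

End DyadicSearch.

(** * Embedding a countable odd chain into a standard one *)

Lemma i01_lub (R : realType) (S : {i01 R} -> Prop) :
  exists s : {i01 R}, forall y, s <= y <-> (forall x, S x -> x <= y).
Proof.
have [[x0 Sx0]|nS] := pselect (exists x, S x); last first.
  exists \bot => y; split=> [_ x Sx|_]; last exact: i01_ge0.
  by case: nS; exists x.
have num01 (x : {i01 R}) : (0 <= x%:num /\ x%:num <= 1)%R.
  by have := i01_ge0 x; have := i01_le1 x; rewrite -!num_le.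
pose E : set R := fun r => exists2 x, S x & r = x%:num%R.
have Eub : has_sup E.
  split; first by exists (x0%:num)%R, x0.
  by exists 1%R => _ [x _ ->]; exact: (num01 x).2.
have sup0 : (0 <= sup E)%R.
  by apply: le_trans (num01 x0).1 _; apply: sup_upper_bound => //; exists x0.
have sup1 : (sup E <= 1)%R.
  by apply: ge_sup => [|_ [x _ ->]]; [case: Eub | exact: (num01 x).2].
exists (Itv01 sup0 sup1) => y; split=> [sy x Sx|H].
  apply: le_trans sy; rewrite -num_le /=.
  by apply: sup_upper_bound => //; exists x.
rewrite -num_le /=; apply: ge_sup => [|_ [x Sx ->]]; first by case: Eub.
by rewrite num_le H.
Qed.

Section Embedding.
Context (R : realType) d (X : orderType d) (A : oddChain X).
Local Notation e := (oc1 A).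

Lemma points_enum : (exists f : nat -> X, forall x, exists n, f n = x) ->
  exists g : nat -> points A, forall w, exists n, g n = w.
Proof.
case=> f f_surj.
pose g0 (u : nat * nat * nat * nat * rat) : points A :=
  let w := Raw (f u.1.1.1.1) (f u.1.1.1.2) (f u.1.1.2) (f u.1.2, u.2) in
  if pselect (raw_valid A w) is left V then Point V else embed A e.
exists (fun n => if unpickle n is Some u then g0 u else embed A e).
case=> -[a h k [x s]] V.
have [[na fa] [nh fh]] := (f_surj a, f_surj h).
have [[nk fk] [nx fx]] := (f_surj k, f_surj x).
exists (pickle (na, nh, nk, nx, s)); rewrite pickleK /g0 /= fa fh fk fx.
by case: pselect => // V'; apply: point_inj.
Qed.

Lemma embed_max a : (forall b, b <= a) -> forall w, ple w (embed A a).
Proof.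
move=> amax w; rewrite /ple; apply: (@strong_le1 _ _ A (tag w).1).
- by rewrite /= tag_mulC /tag_opp oppr0 tag_mul1 //=;
    case/validP: (point_valid w) => // /scale_ge1.
- by rewrite /= tag_mulC /tag_opp oppr0 tag_mul1 //=;
    case/validP: (point_valid w) => // /scale_ge1.
rewrite /strong /= ocmulr1 [leLHS](_ : _ =
  ocmul A (ocmul A (ocmul A (val_of w) (up w)) (tag w).1) (occ A a)).
  by rewrite ocmul_le1 occK.
oc_ac.
Qed.

Lemma embed_min a : (forall b, a <= b) -> forall w, ple (embed A a) w.
Proof.
move=> amin w; rewrite -ple_inv -embedV; apply: embed_max => b.
by rewrite -[b](occK A) le_occ.
Qed.

(** The last clause says that extreme elements of [X] are sent to the endpoints
of the interval. It holds because they remain extreme among the points, and the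
points are dense in the interval. *)
Theorem standard_embedding :
  (exists f : nat -> X, forall x, exists n, f n = x) ->
  (exists a b : X, a < b) ->
  exists (B : oddChain {i01 R}) (j : X -> {i01 R}),
  [/\ {mono j : a b / a <= b},
      forall a b, j (ocmul A a b) = ocmul B (j a) (j b),
      forall a, j (occ A a) = occ B (j a), j e = oc1 B
    & forall a, ((forall b, b <= a) -> forall y, y <= j a) /\
                ((forall b, a <= b) -> forall y, j a <= y)].
Proof.
move=> /points_enum[g g_surj] [a0 [b0 ab0]].
have nontriv : exists w z : points A, ~~ ple z w.
  by exists (embed A a0), (embed A b0); rewrite ple_embed -ltNge.
have tot := @ple_total (points A); have tr := @ple_trans (points A).
have dns : forall w z : points A, ~~ ple z w ->
  exists v, ~~ ple v w /\ ~~ ple z v := @points_dense _ _ A.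
pose i := position_i01 R (@ple (points A)) g_surj.
have i_le := position_i01_le R tot tr g_surj dns.
have i_dense := position_i01_dense (R := R) tot tr g_surj dns nontriv.
exists (completion i_le i_dense (@i01_lub R)), (fun a => i (embed A a)).
split=> [a b|a b|a||a].
- by rewrite i_le ple_embed.
- rewrite embedM; exact: (completionM i_le).
- rewrite embedV; exact: (completionV i_le).
- by [].
split=> H y; rewrite leNgt; apply/negP => /i_dense[w /andP[]].
- by rewrite ltNge i_le embed_max.
- by move=> _; rewrite ltNge i_le embed_min.
Qed.

End Embedding.

(** * FL_e-algebras and odd chains *)

Section FLeOddChain.
Context d (X : orderType d).

Lemma fle_oddE (F : FLe X) : fle_odd F -> ff F = ft F.
Proof.
move=> <-; rewrite /rescompl; apply/le_anti.
by rewrite -fresP fmul1 lexx -{1}(fmul1 F (fres F _ _)) fresP lexx.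
Qed.

Lemma rescomplP (F : FLe X) : fle_odd F ->
  forall x y : X, (x <= rescompl F y) = (fmul F x y <= ft F).
Proof. by move=> odd x y; rewrite fmulC -(fle_oddE odd) fresP. Qed.

Definition oddChain_of_FLe (F : FLe X) (inv : fle_involutive F)
    (odd : fle_odd F) : oddChain X :=
  OddChain (fmulA F) (fmulC F) (fmul1 F) inv (rescomplP odd).

Lemma fres_rescompl (F : FLe X) : fle_involutive F -> fle_odd F ->
  forall x y : X, fres F x y = rescompl F (fmul F x (rescompl F y)).
Proof.
move=> inv odd x y.
have E z : (z <= fres F x y) = (z <= rescompl F (fmul F x (rescompl F y))).
  rewrite -fresP rescomplP // fmulA [fmul F z x]fmulC -{1}[y]inv.
  by rewrite rescomplP.
by apply/le_anti; rewrite E lexx -E lexx.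
Qed.

Section OfOddChain.
Context (A : oddChain X).

Let resP (x y z : X) :
  (ocmul A x y <= z) = (y <= occ A (ocmul A x (occ A z))).
Proof.
rewrite occP -{1}[z](occK A) occP; congr (_ <= _); oc_ac.
Qed.

Definition FLe_of_oddChain : FLe X := @MkFLe d X (ocmul A)
  (fun x y => occ A (ocmul A x (occ A y))) (oc1 A) (oc1 A)
  (@ocmulA _ _ A) (@ocmulC _ _ A) (@ocmul1 _ _ A) resP.

Lemma rescompl_of_oddChain x : rescompl FLe_of_oddChain x = occ A x.
Proof. by rewrite /rescompl /= oc1c ocmulr1. Qed.

Lemma involutive_of_oddChain : fle_involutive FLe_of_oddChain.
Proof. by move=> x; rewrite !rescompl_of_oddChain occK. Qed.

Lemma odd_of_oddChain : fle_odd FLe_of_oddChain.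
Proof. by rewrite /fle_odd rescompl_of_oddChain /= oc1c. Qed.

End OfOddChain.
End FLeOddChain.

(** * Countable subalgebras *)

Section SubChain.
Context d (X : orderType d) (A : oddChain X) (S : pred X).

Definition subchain : Type := {x | S x}.
HB.instance Definition _ := SubType.on subchain.
HB.instance Definition _ := Choice.on subchain.
HB.instance Definition _ := [SubChoice_isSubOrder of subchain by <: with d].

Hypothesis SM : forall x y, S x -> S y -> S (ocmul A x y).
Hypothesis SV : forall x, S x -> S (occ A x).
Hypothesis S1 : S (oc1 A).

Let smul (x y : subchain) : subchain := exist (fun z : X => S z) _ (SM (valP x) (valP y)).
Let sinv (x : subchain) : subchain := exist (fun z : X => S z) _ (SV (valP x)).
Let sone : subchain := exist (fun z : X => S z) _ S1.

Let smulA : associative smul.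
Proof. by move=> x y z; apply: val_inj; rewrite /= ocmulA. Qed.
Let smulC : commutative smul.
Proof. by move=> x y; apply: val_inj; rewrite /= ocmulC. Qed.
Let smul1 : left_id sone smul.
Proof. by move=> x; apply: val_inj; rewrite /= ocmul1. Qed.
Let sinvK : involutive sinv.
Proof. by move=> x; apply: val_inj; rewrite /= occK. Qed.
Let sinvP (x y : subchain) : (x <= sinv y) = (smul x y <= sone).
Proof. by rewrite !leEsub /= occP. Qed.

Definition sub_oddChain : oddChain subchain :=
  OddChain smulA smulC smul1 sinvK sinvP.

End SubChain.

Section FormulaCountable.
Context (K : countType).

Fixpoint encode (phi : formula K) : GenTree.tree (nat + K) :=
  match phi with
  | Var n => GenTree.Leaf (inl n)
  | Const c => GenTree.Leaf (inr c)
  | Tt => GenTree.Node 0 [::]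
  | Ff => GenTree.Node 1 [::]
  | And p q => GenTree.Node 2 [:: encode p; encode q]
  | Or p q => GenTree.Node 3 [:: encode p; encode q]
  | Mul p q => GenTree.Node 4 [:: encode p; encode q]
  | Imp p q => GenTree.Node 5 [:: encode p; encode q]
  end.

Fixpoint decode (u : GenTree.tree (nat + K)) : formula K :=
  match u with
  | GenTree.Leaf (inl n) => Var K n
  | GenTree.Leaf (inr c) => Const c
  | GenTree.Node 1 _ => Ff K
  | GenTree.Node 2 [:: p; q] => And (decode p) (decode q)
  | GenTree.Node 3 [:: p; q] => Or (decode p) (decode q)
  | GenTree.Node 4 [:: p; q] => Mul (decode p) (decode q)
  | GenTree.Node 5 [:: p; q] => Imp (decode p) (decode q)
  | _ => Tt K
  end.

Lemma encodeK : cancel encode decode.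
Proof. by elim=> //= p -> q ->. Qed.

Lemma formula_enum : exists f : nat -> formula K, forall phi, exists n, f n = phi.
Proof.
exists (fun n => if unpickle n is Some u then decode u else Tt K) => phi.
by exists (pickle (encode phi)); rewrite pickleK encodeK.
Qed.

End FormulaCountable.

(** * Transfer of countermodels *)

Section StandardModel.
Context (R : realType) (K : countType).

(** The values of formulas form a countable subalgebra, and it is nontrivial
because the value of [phi] differs from the unit. In a chain, meets and joins are
preserved by any order embedding. The clause on constants serves the language
with bounds. *)
Theorem standard_model d (X : orderType d) (F : FLe X) (k : K -> X)
    (v : nat -> X) (phi : formula K) :
  fle_involutive F -> fle_odd F -> ~ model F k v phi ->
  exists (B : FLe {i01 R}) (k' : K -> {i01 R}) (v' : nat -> {i01 R}),
  [/\ fle_involutive B, fle_odd B,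
      forall psi, model B k' v' psi <-> model F k v psi
    & forall c, ((forall x, x <= k c) -> forall y, y <= k' c) /\
                ((forall x, k c <= x) -> forall y, k' c <= y)].
Proof.
move=> inv odd nphi; pose A := oddChain_of_FLe inv odd.
pose S : pred X := fun x => `[< exists psi, eval F k v psi = x >].
have Se psi : S (eval F k v psi) by apply/asboolP; exists psi.
have SM x y : S x -> S y -> S (ocmul A x y).
  by move=> /asboolP[p <-] /asboolP[q <-]; exact: (Se (Mul p q)).
have SV x : S x -> S (occ A x).
  by move=> /asboolP[p <-]; exact: (Se (Imp p (Ff K))).
have S1 : S (oc1 A) by exact: (Se (Tt K)).
pose C := sub_oddChain SM SV S1.
pose ev psi : subchain S := exist (fun z : X => S z) _ (Se psi).
have enumC : exists f : nat -> subchain S, forall x, exists n, f n = x.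
  have [f f_surj] := formula_enum K; exists (ev \o f) => -[x Sx].
  have [psi E] := asboolP _ Sx; have [n fn] := f_surj psi; exists n.
  by apply: val_inj; rewrite /= fn.
have nontriv : exists a b : subchain S, a < b.
  exists (ev phi), (ev (Tt K)).
  by rewrite ltEsub /= ltNge; apply/negP.
have [B [j [j_le jM jV j1 j_ext]]] := standard_embedding R C enumC nontriv.
pose k' c := j (ev (Const c)); pose v' n := j (ev (Var K n)).
have evE psi : eval (FLe_of_oddChain B) k' v' psi = j (ev psi).
  have jmeet p q : j (ev p) `&` j (ev q) = j (ev (And p q)).
    have [le|le] := orP (le_total (ev p) (ev q)).
      rewrite (meet_l _) ?j_le //; congr j; apply: val_inj => /=.
      by rewrite meet_l //; move: le; rewrite leEsub.
    rewrite (meet_r _) ?j_le //; congr j; apply: val_inj => /=.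
    by rewrite meet_r //; move: le; rewrite leEsub.
  have jjoin p q : j (ev p) `|` j (ev q) = j (ev (Or p q)).
    have [le|le] := orP (le_total (ev p) (ev q)).
      rewrite (join_r _) ?j_le //; congr j; apply: val_inj => /=.
      by rewrite join_r //; move: le; rewrite leEsub.
    rewrite (join_l _) ?j_le //; congr j; apply: val_inj => /=.
    by rewrite join_l //; move: le; rewrite leEsub.
  elim: psi => //= [||p -> q ->|p -> q ->|p -> q ->|p -> q ->].
  - by rewrite -j1; congr j; apply: val_inj.
  - by rewrite -j1; congr j; apply: val_inj; rewrite /= fle_oddE.
  - exact: jmeet.
  - exact: jjoin.
  - by rewrite -jM; congr j; apply: val_inj.
  - rewrite -jV -jM -jV; congr j; apply: val_inj.
    by rewrite /= fres_rescompl.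
exists (FLe_of_oddChain B), k', v'; split.
- exact: involutive_of_oddChain.
- exact: odd_of_oddChain.
- move=> psi; rewrite /model evE /= -j1 j_le leEsub /=.
  by [].
move=> c; have [jmax jmin] := j_ext (ev (Const c)).
split=> [kmax|kmin] y.
- by apply: jmax => b; rewrite leEsub /= kmax.
- by apply: jmin => b; rewrite leEsub /= kmin.
Qed.

End StandardModel.

Definition is_top (c : bound) : bool := if c is Top then true else false.

Lemma is_topK : cancel is_top (fun b => if b then Top else Bot).
Proof. by case. Qed.

HB.instance Definition _ := Countable.copy bound (can_type is_topK).

Lemma subdirect_self d (X : orderType d) (A : FLe X) : subdirect_of_chains A.
Proof.
exists unit, (fun=> d), (fun=> X), (fun=> A), (fun=> id).
by split=> [_|_ y|x x' /(_ tt)]; [split | exists y |].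
Qed.

Lemma eval_hom d d' (X : latticeType d) (Y : latticeType d') (A : FLe X)
    (B : FLe Y) (h : X -> Y) (K : Type) (k : K -> X) (v : nat -> X) :
  fle_hom A B h -> forall phi,
  h (eval A k v phi) = eval B (h \o k) (h \o v) phi.
Proof.
case=> hI hU hM hR ht hf; elim=> //= p <- q <-.
- exact: hI.
- exact: hU.
- exact: hM.
- exact: hR.
Qed.

Lemma hom_le d d' (X : latticeType d) (Y : latticeType d') (A : FLe X)
    (B : FLe Y) (h : X -> Y) : fle_hom A B h -> {homo h : x y / x <= y}.
Proof. by move=> hh x y /meet_idPl <-; rewrite (hom_meet hh) leIr. Qed.

Lemma hom_odd_involutive d d' (X : latticeType d) (Y : latticeType d')
    (A : FLe X) (B : FLe Y) (h : X -> Y) : fle_hom A B h ->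
  (forall y, exists x, h x = y) -> fle_involutive A -> fle_odd A ->
  fle_involutive B /\ fle_odd B.
Proof.
move=> hh h_surj invA oddA.
have hC x : rescompl B (h x) = h (rescompl A x).
  by rewrite /rescompl (hom_res hh) (hom_f hh).
split=> [y|]; last by rewrite /fle_odd -(hom_t hh) hC oddA.
by have [x <-] := h_surj y; rewrite !hC invA.
Qed.

Theorem theorem4p8 (R : realType) :
  (forall (T : set fm) (phi : fm),
     entails_I0sl T phi <->
     (forall A : FLe {i01 R}, I0sl A -> holds_in A T phi))
  /\
  (forall (T : set fm_bounded) (phi : fm_bounded),
     entails_IULfp T phi <->
     (forall A : FLe {i01 R}, IULfp_chain A -> holds_in_bounded A T phi)).
Proof.
split=> T phi; split=> [H A|H].
- exact: H.
- move=> d X A [invA oddA [I [dI [Y [B [h [hh h_surj h_inj]]]]]]] v Tv.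
  apply: contrapT => nphi.
  (* The formula already fails in one of the factors. *)
  have [i nphi_i] : exists i,
      ~ model (B i) (h i \o @no_const X) (h i \o v) phi.
    apply: contrapT => all; apply: nphi; rewrite /model.
    apply/meet_idPl; apply: h_inj => i; rewrite (hom_meet (hh i)).
    apply/meet_idPl; rewrite (hom_t (hh i)) (eval_hom _ _ (hh i)).
    by apply: contrapT => ni; apply: all; exists i.
  have [invB oddB] := hom_odd_involutive (hh i) (h_surj i) invA oddA.
  have [C [k [v' [invC oddC mC _]]]] := standard_model R invB oddB nphi_i.
  apply: nphi_i; apply/mC.
  have -> : k = @no_const _ by apply/funext => -[].
  apply: H => [|psi Tpsi]; first by split=> //; exact: subdirect_self.
  have -> : @no_const _ = k by apply/funext => -[].
  apply/mC; rewrite /model -(hom_t (hh i)) -(eval_hom _ _ (hh i)).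
  exact/(hom_le (hh i))/Tv.
- exact: H.
move=> d X A [invA oddA _] v Tv; apply: contrapT => nphi.
have [C [k [v' [invC oddC mC ext]]]] := standard_model R invA oddA nphi.
have kE : k = @bound_const _ {i01 R}.
  apply/funext => -[] /=; apply/le_anti.
  - by rewrite le0x andbT (ext Bot).2 // => x; exact: le0x.
  - by rewrite lex1 (ext Top).1 // => x; exact: lex1.
apply: nphi; apply/mC; rewrite kE; apply: H => [|psi /Tv]; last first.
  by rewrite -kE => /mC.
split=> //; exists \bot, \top => /(congr1 (fun x : {i01 R} => x%:num%R)) /= /eqP.
by rewrite eq_sym oner_eq0.
Qed.
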